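(* Let $\mathbb V$ be a Schubert representation of $\widehat H_n$ with generic Schubert classes $\{\mathcal Y_w\}$ and equivariant parameters $t_1,\dots,t_n$, and let $f\in\mathcal A_\hbar[x_1,\dots,x_n]$ be symmetric in $x_1,\dots,x_k$ and symmetric in $x_{k+1},\dots,x_n$. (i) For each $\mu\subseteq(n-k)^k$ there are $P_{\lambda,\mu}\in\mathcal A_\hbar[x_1,\dots,x_n]$ with $$\overline T_\mu f=\sum_{\lambda\subseteq(n-k)^k}P_{\lambda,\mu}(x_1,\dots,x_n)\,\overline T_\lambda.$$ (ii) With these $P_{\lambda,\mu}$, for each $\lambda\subseteq(n-k)^k$, $$f\cdot\mathcal Y_\lambda=\sum_{\mu\subseteq(n-k)^k}P_{\lambda,\mu}(t_1,\dots,t_n)\,\mathcal Y_\mu.$$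
   Context: $\mathcal A_\hbar=\mathbb Q[p,q,\hbar]$; $\widehat H_n$ is the $\mathcal A_\hbar$-algebra generated by $T_1,\dots,T_{n-1},x_1,\dots,x_n$ with relations $(T_i+p)(T_i-q)=0$, $T_iT_j=T_jT_i$ ($|i-j|>1$), $T_iT_{i+1}T_i=T_{i+1}T_iT_{i+1}$, $x_ix_j=x_jx_i$, $T_ix_j=x_jT_i$ ($j\ne i,i+1$), $T_ix_i=x_{i+1}T_i+(\hbar-(p-q)x_i)$, $T_ix_{i+1}=x_iT_i-(\hbar-(p-q)x_i)$. $T_w,\overline T_w$ are defined via reduced words, with $\overline T_i=T_i+p-q$. Schubert representation: field $\mathbb F$, $t_1,\dots,t_n\in\mathbb F$, ring map $\mathcal A_\hbar\to\mathbb F$, $\mathbb F$-space $\mathbb V$ with $\widehat H_n$-action (scalars of $\mathcal A_\hbar$ via $\mathbb F$), basis $\mathcal Y_w=T_{w^{-1}w_0}\cdot\mathcal Y_{w_0}$, and $\mathbb F$-linear $\operatorname{ev}$ with $\operatorname{ev}(\mathcal Y_w)\ne0\iff w=\mathrm{id}$ and $\operatorname{ev}(x_i\mathcal Y_w)=t_i\operatorname{ev}(\mathcal Y_w)$. Partitions $\lambda\subseteq(n-k)^k$: $n-k\ge\lambda_1\ge\dots\ge\lambda_k\ge0$; $w_\lambda\in S_n$ with $w_\lambda(k+1-i)=\lambda_i+k+1-i$ ($1\le i\le k$), increasing on $\{k+1,\dots,n\}$; every $w\in S_n$ factors uniquely as $w=w_\lambda v$ with $v\in S_k\times S_{n-k}$,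 and we write $\operatorname{Gr}(w)=\lambda$. Quantum numbers $[m]=(p^m-q^m)/(p-q)$, $[m]!=[m][m-1]\cdots[1]$, $[0]!=1$; $d=\binom k2+\binom{n-k}2$. Define $\Sigma^n_k=\frac1{[k]![n-k]!}\sum_{v\in S_k\times S_{n-k}}q^{d-\ell(v)}\overline T_v$ (scalars extended so that $[k]![n-k]!$ is invertible), $\overline T_\lambda=\overline T_{w_\lambda}\Sigma^n_k$, and $\mathcal Y_\lambda=\sum_{v\in S_k\times S_{n-k}}p^{\ell(v)}\mathcal Y_{w_\lambda v}$. $P(t_1,\dots,t_n)$ means the image in $\mathbb F$ under $x_i\mapsto t_i$. *)

(* Defs.v *)
From HB Require Import structures.
From mathcomp Require Import all_boot all_order all_algebra all_fingroup.
From mathcomp Require Import mpoly.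
Set Implicit Arguments. Unset Strict Implicit. Unset Printing Implicit Defensive.
Import GRing.Theory.
Local Open Scope ring_scope.

Notation Ah := {mpoly rat[3]}.
Definition pp : Ah := 'X_(@inord 2 0).
Definition qq : Ah := 'X_(@inord 2 1).
Definition hb : Ah := 'X_(@inord 2 2).

(* quantum numbers [m] = (p^m - q^m)/(p - q) = sum_{i<m} p^i q^(m-1-i) *)
Definition qnum (m : nat) : Ah := \sum_(i < m) pp ^+ i * qq ^+ (m.-1 - i).
Definition qfact (m : nat) : Ah := \prod_(1 <= i < m.+1) qnum i.

(* simple transposition s_i swapping i and i+1 (meaningful for i.+1 < n) *)
Definition sref (n i : nat) : 'S_n :=
  match n return 'S_n with 0 => 1%g | m.+1 => tperm (inord i) (inord i.+1) end.

(* word_perm [:: i1; ...; il] = s_i1 o ... o s_il (function composition;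
   note that mathcomp's (a * b)%g is "first a, then b") *)
Definition word_perm (n : nat) (s : seq nat) : 'S_n :=
  foldr (fun i w => (w * sref n i)%g) 1%g s.

Definition plen (n : nat) (w : 'S_n) : nat :=
  #|[set ij : 'I_n * 'I_n | (ij.1 < ij.2)%N && (w ij.2 < w ij.1)%N]|.

Definition pcomp (n : nat) (a b : 'S_n) : 'S_n := (b * a)%g.

Definition w0 (n : nat) : 'S_n := perm (@rev_ord_inj n).

Definition rword (n : nat) (w : 'S_n) : option ((plen w).-tuple 'I_n.-1) :=
  [pick t : (plen w).-tuple 'I_n.-1 | word_perm n (map val t) == w].

Definition Tw (n : nat) (R : ringType) (G : nat -> R) (w : 'S_n) : R :=
  match rword w with Some t => \prod_(i <- t) G (val i) | None => 1 end.

Definition opw (n : nat) (V : Type) (G : nat -> V -> V) (w : 'S_n) : V -> V :=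
  match rword w with
  | Some t => foldr (fun i g => G (val i) \o g) id t
  | None => id
  end.

Definition young (n k : nat) (v : 'S_n) : bool :=
  [forall i : 'I_n, (v i < k)%N == (i < k)%N].

Definition part (n k : nat) := (k.-tuple 'I_(n - k).+1).
Definition is_part (n k : nat) (l : part n k) : bool :=
  [forall i : 'I_k, forall j : 'I_k, (i <= j)%N ==> (tnth l j <= tnth l i)%N].

(* lambda_i (1-based i) = nth 0 l (i-1). w_lambda(k+1-i) = lambda_i + k+1-i
   (1-based), i.e. (0-based, j < k) w_lambda(j) = lambda_(k-j) + j,
   increasing on {k,...,n-1}. *)
Definition wl (n k : nat) (l : part n k) : 'S_n :=
  odflt 1%g [pick w : 'S_n |
    [forall j : 'I_n, (j < k)%N ==>
        (val (w j) == nth 0%N [seq val x | x <- l] (k.-1 - j) + j)%N]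
    && [forall i : 'I_n, forall j : 'I_n, (k <= i)%N && (i < j)%N ==> (w i < w j)%N]].

Definition hecke_rel (n : nat) (H : algType Ah) (T X : nat -> H) : Prop :=
  (forall i, (i.+1 < n)%N -> (T i + pp%:A) * (T i - qq%:A) = 0) /\
  (forall i j, (i.+1 < n)%N -> (j.+1 < n)%N -> (i.+1 < j \/ j.+1 < i)%N ->
     T i * T j = T j * T i) /\
  (forall i, (i.+2 < n)%N -> T i * T i.+1 * T i = T i.+1 * T i * T i.+1) /\
  (forall i j, (i < n)%N -> (j < n)%N -> X i * X j = X j * X i) /\
  (forall i j, (i.+1 < n)%N -> (j < n)%N -> j <> i -> j <> i.+1 ->
     T i * X j = X j * T i) /\
  (forall i, (i.+1 < n)%N ->
     T i * X i = X i.+1 * T i + (hb%:A - (pp - qq) *: X i)) /\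
  (forall i, (i.+1 < n)%N ->
     T i * X i.+1 = X i * T i - (hb%:A - (pp - qq) *: X i)).

Definition Tbar (H : algType Ah) (T : nat -> H) (i : nat) : H := T i + (pp - qq)%:A.

Definition heval (n : nat) (H : algType Ah) (X : nat -> H) (f : {mpoly Ah[n]}) : H :=
  mmap (fun a : Ah => a%:A) (fun i : 'I_n => X (val i)) f.

Definition dd (n k : nat) : nat := ('C(k, 2) + 'C(n - k, 2))%N.

(* Sigma^n_k, where ci is the inverse of [k]![n-k]! *)
Definition Sigma (n k : nat) (H : algType Ah) (T : nat -> H) (ci : H) : H :=
  ci * \sum_(v : 'S_n | young k v) (qq ^+ (dd n k - plen v))%:A * Tw (Tbar T) v.

Definition Tlam (n k : nat) (H : algType Ah) (T : nat -> H) (ci : H)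
  (l : part n k) : H := Tw (Tbar T) (wl l) * Sigma n k T ci.

Definition bisym (n k : nat) (f : {mpoly Ah[n]}) : Prop :=
  forall s : 'S_n, young k s -> msym s f = f.

(* Statement (i) for a family P: the identity holds in (the localization at
   [k]![n-k]! of) the algebra presented by generators T_i, x_i and the above
   relations, i.e. in every A_hbar-algebra with such elements. *)
Definition expansion (n k : nat) (f : {mpoly Ah[n]})
  (P : part n k -> part n k -> {mpoly Ah[n]}) : Prop :=
  forall (H : algType Ah) (T X : nat -> H) (ci : H),
    hecke_rel n T X ->
    ci * (qfact k * qfact (n - k))%:A = 1 ->
    (qfact k * qfact (n - k))%:A * ci = 1 ->
    forall mu : part n k, is_part mu ->
      Tlam T ci mu * heval X f
      = \sum_(l : part n k | is_part l) heval X (P l mu) * Tlam T ci l.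

Definition opmono (n : nat) (V : Type) (X : nat -> V -> V) (m : 'X_{1..n}) : V -> V :=
  foldr (fun i g => iter (m i) (X (val i)) \o g) id (enum 'I_n).

Definition opeval (n : nat) (F : fieldType) (phi : Ah -> F) (V : lmodType F)
  (X : nat -> V -> V) (f : {mpoly Ah[n]}) (v : V) : V :=
  \sum_(m <- msupp f) phi f@_m *: opmono X m v.

Definition hecke_action (n : nat) (F : fieldType) (phi : Ah -> F) (V : lmodType F)
  (T X : nat -> V -> V) : Prop :=
  (forall i a u v, (i.+1 < n)%N -> T i (a *: u + v) = a *: T i u + T i v) /\
  (forall i a u v, (i < n)%N -> X i (a *: u + v) = a *: X i u + X i v) /\
  (forall i v, (i.+1 < n)%N ->
     (fun u => T i u + phi pp *: u) ((fun u => T i u - phi qq *: u) v) = 0) /\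
  (forall i j v, (i.+1 < n)%N -> (j.+1 < n)%N -> (i.+1 < j \/ j.+1 < i)%N ->
     T i (T j v) = T j (T i v)) /\
  (forall i v, (i.+2 < n)%N -> T i (T i.+1 (T i v)) = T i.+1 (T i (T i.+1 v))) /\
  (forall i j v, (i < n)%N -> (j < n)%N -> X i (X j v) = X j (X i v)) /\
  (forall i j v, (i.+1 < n)%N -> (j < n)%N -> j <> i -> j <> i.+1 ->
     T i (X j v) = X j (T i v)) /\
  (forall i v, (i.+1 < n)%N ->
     T i (X i v) = X i.+1 (T i v) + (phi hb *: v - phi (pp - qq) *: X i v)) /\
  (forall i v, (i.+1 < n)%N ->
     T i (X i.+1 v) = X i (T i v) - (phi hb *: v - phi (pp - qq) *: X i v)).

Definition Ysch (n : nat) (V : Type) (T : nat -> V -> V) (Y0 : V) (w : 'S_n) : V :=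
  opw T (pcomp (w^-1)%g (w0 n)) Y0.

Definition schubert_rep (n : nat) (F : fieldType) (phi : {rmorphism Ah -> F})
  (t : nat -> F) (V : vectType F) (T X : nat -> V -> V) (Y0 : V) (ev : V -> F) : Prop :=
  hecke_action n phi T X /\
  basis_of fullv [seq Ysch T Y0 w | w : 'S_n] /\
  (forall a u v, ev (a *: u + v) = a * ev u + ev v) /\
  (forall w : 'S_n, (ev (Ysch T Y0 w) != 0) = (w == 1%g)) /\
  (forall i (w : 'S_n), (i < n)%N -> ev (X i (Ysch T Y0 w)) = t i * ev (Ysch T Y0 w)).

Definition Ylam (n k : nat) (F : fieldType) (phi : Ah -> F) (V : lmodType F)
  (T : nat -> V -> V) (Y0 : V) (l : part n k) : V :=
  \sum_(v : 'S_n | young k v) phi (pp ^+ plen v) *: Ysch T Y0 (pcomp (wl l) v).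

(* Main.v *)
Require Import Defs.
From HB Require Import structures.
From mathcomp Require Import all_boot all_order all_algebra all_fingroup.
From mathcomp Require Import fraction mpoly zify ring.
Import GRing.Theory.
Set Implicit Arguments. Unset Strict Implicit. Unset Printing Implicit Defensive.
Local Open Scope ring_scope.

(** Moving the [x]'s to the left gives universal polynomials [Q w u] with
    [Tbar_w f = sum_u Q w u Tbar_u].  Since [Tbar_v Sigma = p^l(v) Sigma] for [v]
    in the Young subgroup and [Sigma] commutes with [f], multiplying by [Sigma]
    and writing [u = w_l v] gives (i) with [P l mu = sum_v p^l(v) Q w_mu (w_l v)].

    In a Schubert representation, [ev (Tbar_u Y_w)] is [ev Y_1] if [u = w] and [0]
    otherwise, and [ev (g v) = g(t) ev v] for a polynomial [g], so the coefficient
    of [Y_u] in [f Y_l] is the value at [t] of [sum_v p^l(v) Q u (w_l v)].  For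
    [u = w_mu v'] this sum is [p^l(v') P l mu].  As [[k]![n-k]!] may vanish in the
    given field, (i) cannot be used there; instead the last identity is proved
    between polynomials, by evaluating (i) in the principal series representation
    over the field of fractions of [Ah[x]], where the [Tbar_w] are linearly
    independent over the polynomials. *)

(** * Permutations, reduced words and Matsumoto's theorem *)

(** Part (ii) concerns every family [P] that satisfies (i), not just the one that is constructed, so
    it needs uniqueness of [P]. But [P] is known only through identities in algebras where
    [[k]![n-k]!] is invertible, while the field of a Schubert representation may kill [p], [q] or a
    quantum number. Hence the comparison takes place in one model where nothing vanishes: its
    parameters are independent variables, so a polynomial is zero as soon as its value is, and the
    coefficients [p x - q y - h] of the intertwining part of [T_i] are nonzero, which makes the
    action of the [Tbar_w] triangular with respect to length.

    The pairing [ev (Tbar_u Y_w)] is diagonal because the quadratic relation reads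
    [Tbar_i T_i = p q], while [T_i] by itself moves [Y_w] to a shorter index. No division by [p q]
    is made anywhere on that side.

    Products of permutations compose from left to right: [sref n i * w] appends the letter [i] at
    the right end of a word of [w], and [v * wl l] is the permutation written [w_l v]. *)

Section Permutations.
Variable n : nat.
Implicit Types (w u v : 'S_n) (i j : nat) (s t : seq nat).
Local Open Scope nat_scope.

Notation asc w i hi := (w (Ordinal (ltnW hi)) < w (Ordinal hi)).

Lemma sref_tperm i (hi : i.+1 < n) :
  sref n i = tperm (Ordinal (ltnW hi)) (Ordinal hi).
Proof.
case: n hi => // m hi /=.
by congr tperm; apply: val_inj; rewrite /= inordK // ltnW.
Qed.

Lemma srefE i (a : 'I_n) : i.+1 < n ->
  nat_of_ord (sref n i a) = if a == i :> nat then i.+1 else if a == i.+1 :> nat then i else a.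
Proof.
move=> hi; rewrite (sref_tperm hi).
case: tpermP => [->|->|/eqP + /eqP +] /=; first by rewrite eqxx.
  by rewrite eqxx; case: eqP => //; lia.
by rewrite -!val_eqE /= => /negbTE -> /negbTE ->.
Qed.

Lemma srefK i : (sref n i * sref n i = 1)%g.
Proof. by case: n => [|m] /=; rewrite ?mulg1 // tperm2. Qed.

Lemma srefV i : ((sref n i)^-1 = sref n i)%g.
Proof. by apply/eqP; rewrite eq_invg_mul srefK. Qed.

Lemma srefM_K i w : (sref n i * (sref n i * w) = w)%g.
Proof. by rewrite mulgA srefK mul1g. Qed.

Lemma sref_l i (hi : i.+1 < n) : sref n i (Ordinal (ltnW hi)) = Ordinal hi.
Proof. by rewrite (sref_tperm hi) tpermL. Qed.

Lemma sref_r i (hi : i.+1 < n) : sref n i (Ordinal hi) = Ordinal (ltnW hi).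
Proof. by rewrite (sref_tperm hi) tpermR. Qed.

(** Swapping [i] and [i.+1] in both coordinates carries the inversions of [w] onto those of
    [sref n i * w] other than [(i, i.+1)], which is the one new inversion. *)
Lemma plen_asc w i (hi : i.+1 < n) : asc w i hi ->
  plen (sref n i * w)%g = (plen w).+1.
Proof.
move=> aw; set ai := Ordinal (ltnW hi); set aj := Ordinal hi.
pose phi (x : 'I_n * 'I_n) := (sref n i x.1, sref n i x.2).
have sK : involutive (sref n i).
  by move=> x; rewrite -permM srefK perm1.
have phiK : involutive phi by case=> x y; rewrite /phi /= !sK.
have memphi (A : {set 'I_n * 'I_n}) x : (x \in phi @: A) = (phi x \in A).
  by rewrite -{1}[x]phiK mem_imset //; exact: can_inj phiK.
rewrite /plen; set A := [set _ | _] ; set B := [set _ | _].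
have -> : A = (ai, aj) |: phi @: B.
  apply/setP=> -[a b]; rewrite !inE memphi inE /= !permM xpair_eqE -!val_eqE /=.
  rewrite !srefE //.
  have [ea|na] := eqVneq (nat_of_ord a) i; have [eb|nb] := eqVneq (nat_of_ord b) i.
  - by have -> : b = a by [apply: ord_inj; rewrite eb ea]; rewrite !ltnn /=; lia.
  - have -> : a = ai by apply: val_inj.
    rewrite sref_l -/aj.
    have [eb'|nb'] := eqVneq (nat_of_ord b) i.+1.
      have -> : b = aj by apply: val_inj.
      by rewrite sref_r aw /=; lia.
    by rewrite /=; lia.
  - have -> : b = ai by apply: val_inj.
    rewrite sref_l -/aj.
    have [eb'|nb'] := eqVneq (nat_of_ord a) i.+1.
      have -> : a = aj by apply: val_inj.
      by move: aw; rewrite sref_r -/ai -/aj /=; lia.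
    by rewrite /=; lia.
  - by rewrite /=; case: ifP; case: ifP; lia.
rewrite cardsU1 memphi inE /phi /= sref_l sref_r /= card_imset; last exact: can_inj phiK.
by have -> : (i.+1 < i) = false by [lia]; rewrite andFb add1n.
Qed.

Lemma plen_desc w i (hi : i.+1 < n) : ~~ asc w i hi ->
  plen w = (plen (sref n i * w)%g).+1.
Proof.
move=> dw; rewrite -(plen_asc (hi := hi)) ?srefM_K //.
rewrite !permM sref_l sref_r ltn_neqAle leqNgt dw andbT.
by apply/eqP=> /ord_inj /perm_inj [] /eqP; lia.
Qed.

Lemma asc_sref w i (hi : i.+1 < n) : asc (sref n i * w)%g i hi = ~~ asc w i hi.
Proof.
rewrite !permM sref_l sref_r -leqNgt ltn_neqAle.
case: eqP => //= /ord_inj /perm_inj [] /eqP; lia.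
Qed.

Lemma plenV w : plen (w^-1)%g = plen w.
Proof.
have le (u : 'S_n) : plen u <= plen (u^-1)%g.
  pose phi (x : 'I_n * 'I_n) := (u x.2, u x.1).
  have inj : injective phi by move=> [a b] [c d] [/perm_inj -> /perm_inj ->].
  rewrite /plen -(card_imset _ inj) subset_leq_card //.
  apply/subsetP=> x /imsetP[[a b]]; rewrite inE /= => /andP[h1 h2] ->.
  by rewrite inE /= !permK h1 h2.
by apply/eqP; rewrite eqn_leq le -{2}[w]invgK le.
Qed.

Lemma plen1 : plen (1%g : 'S_n) = 0.
Proof.
apply/eqP; rewrite cards_eq0; apply/eqP/setP=> -[a b].
by rewrite !inE /= !perm1; lia.
Qed.

Lemma no_desc w : (forall i (hi : i.+1 < n), asc w i hi) -> w = 1%g.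
Proof.
move=> aw.
have mono (a b : 'I_n) : a < b -> w a < w b.
  case: b => b hb /=; elim: b hb => // b IH hb lab.
  apply: leq_trans (aw b hb); rewrite ltnS.
  have [eab|nab] := eqVneq (nat_of_ord a) b.
    by have -> : a = Ordinal (ltnW hb) by apply: val_inj.
  by apply/ltnW/IH; lia.
have ge (a : 'I_n) : a <= w a.
  case: a => a ha; elim: a ha => // a IH ha /=.
  by apply: leq_trans (aw a ha); rewrite ltnS; exact: (IH (ltnW ha)).
have le (a : 'I_n) : w a <= a.
  suff gen d : forall a : 'I_n, n = (a + d.+1) -> w a <= a.
    by apply: (gen (n - a).-1); case: a => a ha /=; lia.
  elim: d => [|d IH] [c hc] /= e; first by have := ltn_ord (w (Ordinal hc)); lia.
  have hc' : c.+1 < n by lia.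
  have /= := IH (Ordinal hc'); have := aw c hc'.
  rewrite (_ : Ordinal (ltnW hc') = Ordinal hc); last exact: val_inj.
  lia.
apply/permP=> a; rewrite perm1; apply/val_inj/eqP.
by rewrite eqn_leq le ge.
Qed.

Lemma desc_ex w : w != 1%g -> exists i (hi : i.+1 < n), ~~ asc w i hi.
Proof.
move=> nw.
have [/existsP[[i hi] h]|] := boolP [exists i : 'I_n,
    if insub i.+1 is Some j then (w j < w i) else false].
  move: h; case: insubP => // -[j hj] /= hj' ej; subst j => lw.
  exists i, hj'; rewrite -leqNgt.
  rewrite (_ : Ordinal (ltnW hj') = Ordinal hi); last exact: val_inj.
  by rewrite (_ : Ordinal hj' = Ordinal hj); [exact: ltnW | exact: val_inj].
rewrite negb_exists => /forallP h; case/eqP: nw; apply: no_desc => i hi.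
have /= := h (Ordinal (ltnW hi)); rewrite insubT -leqNgt leq_eqVlt /=.
rewrite (_ : Sub i.+1 hi = Ordinal hi) //.
by case/orP=> // /eqP/ord_inj/perm_inj [] /eqP; lia.
Qed.

(* [sref n i * w] is [w] composed with [s_i] on the right. *)
Lemma perm_ind_right (P : 'S_n -> Prop) : P 1%g ->
  (forall w i (hi : i.+1 < n), asc w i hi -> P w -> P (sref n i * w)%g) ->
  forall w, P w.
Proof.
move=> P1 PS w; move en : (plen w) => m; elim: m w en => [|m IH] w ew;
  have [-> //|/desc_ex[i [hi dw]]] := eqVneq w 1%g.
  by have := plen_desc dw; rewrite ew.
rewrite -(srefM_K i w); apply: (PS _ _ hi); first by rewrite asc_sref.
by apply: IH; have := plen_desc dw; rewrite ew => -[].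
Qed.

Lemma plen_sref_le w i : i.+1 < n -> plen (sref n i * w)%g <= (plen w).+1.
Proof.
move=> hi; case: (boolP (asc w i hi)) => [/plen_asc -> //|/plen_desc ->].
by rewrite leqW.
Qed.

Lemma word_perm_cat s t : word_perm n (s ++ t) = (word_perm n t * word_perm n s)%g.
Proof. by elim: s => [|i s IH] /=; rewrite ?mulg1 // IH mulgA. Qed.

Lemma word_perm_rcons s i : word_perm n (rcons s i) = (sref n i * word_perm n s)%g.
Proof. by rewrite -cats1 word_perm_cat /= mul1g. Qed.

Definition validw s := all (fun i => i.+1 < n) s.

Lemma plen_word s : validw s -> plen (word_perm n s) <= size s.
Proof.
elim/last_ind: s => [|s i IH]; first by rewrite plen1.
rewrite /validw all_rcons word_perm_rcons size_rcons => /andP[hi /IH].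
by rewrite -ltnS; apply: leq_trans; apply: plen_sref_le.
Qed.

Definition reduced s w := [/\ validw s, word_perm n s = w & size s = plen w].

Lemma reduced_rcons s i w : reduced (rcons s i) w ->
  exists hi : i.+1 < n, ~~ asc w i hi /\ reduced s (sref n i * w)%g.
Proof.
case; rewrite /validw all_rcons word_perm_rcons size_rcons => /andP[hi vs] ew sw.
exists hi; rewrite -ew srefM_K.
have le := plen_word vs.
have dw : ~~ asc w i hi.
  apply/negP=> aw; have := plen_asc aw; rewrite -{1}ew srefM_K; lia.
rewrite ew; split=> //; split=> //.
by have := plen_desc dw; rewrite -{2}ew srefM_K; lia.
Qed.

Lemma reduced_add s i w (hi : i.+1 < n) : asc w i hi -> reduced s w ->
  reduced (rcons s i) (sref n i * w)%g.
Proof.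
move=> aw [vs ew sw]; split; first by rewrite /validw all_rcons hi.
  by rewrite word_perm_rcons ew.
by rewrite size_rcons sw (plen_asc aw).
Qed.

Lemma reduced_ex w : exists s, reduced s w.
Proof.
elim/perm_ind_right: w => [|w i hi aw [s rs]].
  by exists [::]; split=> //; rewrite plen1.
by exists (rcons s i); apply: reduced_add rs.
Qed.

Lemma word_perm_rev s : word_perm n (rev s) = ((word_perm n s)^-1)%g.
Proof.
elim: s => [|i s IH] /=; first by rewrite invg1.
by rewrite rev_cons word_perm_rcons IH invMg srefV.
Qed.

Lemma reduced_rev s w : reduced s w -> reduced (rev s) (w^-1)%g.
Proof.
case=> vs ew sw; split; first by rewrite /validw all_rev.
  by rewrite word_perm_rev ew.
by rewrite size_rev plenV.
Qed.

(** Reversing a word inverts its permutation, so this is [reduced_add] for [w^-1]. *)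
Lemma reduced_cons s i w (hi : i.+1 < n) : asc (w^-1)%g i hi -> reduced s w ->
  reduced (i :: s) (w * sref n i)%g.
Proof.
move=> aw /reduced_rev rs; have /reduced_rev := reduced_add aw rs.
by rewrite rev_rcons revK invMg invgK srefV.
Qed.

End Permutations.

(** * Independence of the reduced word, and the elements [T_w] *)

Section Matsumoto.
Variable n : nat.
Implicit Types (w u v : 'S_n) (i j : nat) (s t : seq nat).
Local Open Scope nat_scope.

(* The value of [w] at [i], and [0] for [i >= n]. *)
Definition pv w i : nat := oapp (fun x : 'I_n => nat_of_ord (w x)) 0 (insub i).

Lemma pvE w i (hi : i < n) : pv w i = w (Ordinal hi).
Proof. by rewrite /pv insubT. Qed.

Lemma pv_ord w (i : 'I_n) : pv w i = w i.
Proof. by rewrite pvE; congr (nat_of_ord (w _)); apply: val_inj. Qed.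

Lemma pv_sref w i j : j.+1 < n ->
  pv (sref n j * w)%g i = pv w (if i == j then j.+1 else if i == j.+1 then j else i).
Proof.
move=> hj; case: (ltnP i n) => hi; first by rewrite pvE permM -pv_ord srefE.
have /negbTE -> : i != j by lia.
have /negbTE -> : i != j.+1 by lia.
by rewrite /pv insubF // ltnNge hi.
Qed.

Lemma pv_inj w i j : i < n -> j < n -> pv w i = pv w j -> i = j.
Proof. by move=> hi hj; rewrite (pvE _ hi) (pvE _ hj) => /ord_inj/perm_inj []. Qed.

Lemma ascE w i (hi : i.+1 < n) :
  (w (Ordinal (ltnW hi)) < w (Ordinal hi)) = (pv w i < pv w i.+1).
Proof. by rewrite (pvE _ hi) (pvE _ (ltnW hi)). Qed.

Lemma sref_comm i j : i.+1 < n -> j.+1 < n -> i.+1 < j ->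
  (sref n i * sref n j = sref n j * sref n i)%g.
Proof.
move=> hi hj lij; apply/permP=> a; rewrite !permM; apply: ord_inj.
by rewrite !srefE //; repeat case: ifP; lia.
Qed.

Lemma sref_braid i : i.+2 < n ->
  (sref n i * sref n i.+1 * sref n i = sref n i.+1 * sref n i * sref n i.+1)%g.
Proof.
move=> hi; apply/permP=> a; rewrite !permM; apply: ord_inj.
by rewrite !srefE //; [repeat case: ifP; lia | lia ..].
Qed.

Lemma asc_pv_sref w i : i.+1 < n ->
  (pv (sref n i * w)%g i < pv (sref n i * w)%g i.+1) = ~~ (pv w i < pv w i.+1).
Proof. by move=> hi; rewrite -(ascE _ hi) asc_sref ascE. Qed.

Lemma reduced_add_pv s i w : i.+1 < n -> pv w i < pv w i.+1 -> reduced s w ->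
  reduced (rcons s i) (sref n i * w)%g.
Proof. by move=> hi; rewrite -(ascE _ hi); apply: reduced_add. Qed.

Lemma reduced_rcons_pv s i w : reduced (rcons s i) w ->
  [/\ i.+1 < n, pv w i.+1 < pv w i & reduced s (sref n i * w)%g].
Proof.
case/reduced_rcons=> hi []; rewrite ascE => h r; split=> //.
rewrite ltn_neqAle leqNgt h andbT; apply/eqP=> /pv_inj; lia.
Qed.

Definition braided (R : nzRingType) (G : nat -> R) : Prop :=
  (forall i j, i.+1 < n -> j.+1 < n -> i.+1 < j \/ j.+1 < i ->
     (G i * G j = G j * G i)%R) /\
  (forall i, i.+2 < n -> (G i * G i.+1 * G i = G i.+1 * G i * G i.+1)%R).

(** Induction on length, comparing the last letters [i] and [j] of the two words. Both are descents
    of [w], so [w] has reduced words ending in either expression of the longest element of the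
    subgroup generated by [s_i] and [s_j]. These bridge the two given words at the cost of a single
    relation. *)
Lemma matsumoto (R : nzRingType) (G : nat -> R) s t w : braided G ->
  reduced s w -> reduced t w -> (\prod_(i <- s) G i = \prod_(i <- t) G i)%R.
Proof.
move=> [Gc Gb]; have Gr x r : (\prod_(i <- rcons r x) G i = (\prod_(i <- r) G i) * G x)%R.
  by rewrite -cats1 big_cat big_seq1.
move em : (plen w) => m; elim: m w em s t => [|m IH] w ew s t rs rt.
  by move: rs rt => [_ _]; rewrite ew => /size0nil -> [_ _]; rewrite ew => /size0nil ->.
have [s' [i es]] : exists s' i, s = rcons s' i.
  by move: rs => [_ _]; rewrite ew; case/lastP: s => // s' i; exists s', i.
have [t' [j et]] : exists t' j, t = rcons t' j.
  by move: rt => [_ _]; rewrite ew; case/lastP: t => // t' j; exists t', j.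
move: rs rt; rewrite {}es {}et !Gr.
wlog lij : i j s' t' / i <= j.
  move=> th rs rt; case: (leqP i j) => [|/ltnW] lij; first exact: th.
  by symmetry; apply: th.
move=> /reduced_rcons_pv[hi di rs'] /reduced_rcons_pv[hj dj rt'].
have pl k z : k.+1 < n -> pv z k.+1 < pv z k -> plen z = (plen (sref n k * z)%g).+1.
  by move=> hk dz; rewrite -(plen_desc (hi := hk)) // ascE; lia.
have plm k : k.+1 < n -> pv w k.+1 < pv w k -> plen (sref n k * w)%g = m.
  by move=> hk /pl; rewrite ew => /(_ hk) [].
have IH' k q r : k.+1 < n -> pv w k.+1 < pv w k -> reduced q (sref n k * w)%g ->
    reduced r (sref n k * w)%g -> (\prod_(i <- q) G i = \prod_(i <- r) G i)%R.
  by move=> hk dk; apply: IH; apply: plm.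
have [eij|nij] := eqVneq i j; first by subst j; rewrite (IH' i s' t').
have [eij|nij'] := eqVneq j i.+1.
  subst j.
  set w1 := (sref n i * w)%g in rs'; set w1' := (sref n i.+1 * w)%g in rt'.
  (* [w3] is [w] stripped of [s_i s_(i+1) s_i]. A reduced word [r] of it extends to a word of [w1]
     ending in [i, i.+1] and to a word of [w1'] ending in [i.+1, i], to which the induction
     hypothesis applies. *)
  pose w2 := (sref n i.+1 * w1)%g; pose w3 := (sref n i * w2)%g.
  pose w2' := (sref n i * w1')%g.
  have e3 : w3 = (sref n i.+1 * w2')%g.
    by rewrite /w3 /w2 /w1 /w2' /w1' !mulgA sref_braid.
  have [r rr] := reduced_ex w3.
  have r2 : reduced (rcons r i) w2.
    rewrite -[w2](srefM_K i) -/w3; apply: reduced_add_pv => //.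
    rewrite asc_pv_sref // /w2 /w1 !pv_sref //.
    by move: di dj; repeat (case: eqP; try lia).
  have r1 : reduced (rcons (rcons r i) i.+1) w1.
    rewrite -[w1](srefM_K i.+1) -/w2; apply: reduced_add_pv => //.
    rewrite asc_pv_sref // /w1 !pv_sref //.
    by move: di dj; repeat (case: eqP; try lia).
  have r2' : reduced (rcons r i.+1) w2'.
    rewrite -[w2'](srefM_K i.+1) -e3; apply: reduced_add_pv => //.
    rewrite e3 asc_pv_sref // /w2' /w1' !pv_sref //.
    by move: di dj; repeat (case: eqP; try lia).
  have r1' : reduced (rcons (rcons r i.+1) i) w1'.
    rewrite -[w1'](srefM_K i) -/w2'; apply: reduced_add_pv => //.
    rewrite asc_pv_sref // /w1' !pv_sref //.
    by move: di dj; repeat (case: eqP; try lia).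
  rewrite (IH' _ _ _ hi di rs' r1) (IH' _ _ _ hj dj rt' r1') !Gr -!mulrA.
  by have := Gb i hj; rewrite -!mulrA => ->.
have lij' : i.+1 < j by lia.
(* In the commuting case, [u] is [w] stripped of both letters [i] and [j]. *)
pose u := (sref n j * (sref n i * w))%g.
have eu : u = (sref n i * (sref n j * w))%g by rewrite /u !mulgA -(sref_comm hi hj lij').
have [r rr] := reduced_ex u.
have r1 : reduced (rcons r j) (sref n i * w)%g.
  rewrite -[(sref n i * w)%g](srefM_K j) -/u; apply: reduced_add_pv => //.
  rewrite asc_pv_sref // !pv_sref //.
  by move: di dj; repeat (case: eqP; try lia).
have r2 : reduced (rcons r i) (sref n j * w)%g.
  rewrite -[(sref n j * w)%g](srefM_K i) -eu; apply: reduced_add_pv => //.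
  rewrite eu asc_pv_sref // !pv_sref //.
  by move: di dj; repeat (case: eqP; try lia).
rewrite (IH' _ _ _ hi di rs' r1) (IH' _ _ _ hj dj rt' r2) !Gr -!mulrA.
by rewrite (Gc i j) //; left.
Qed.

(** Since a reduced word exists, the [pick] in [rword] succeeds and the default [1] in [Tw] is never
    taken. *)
Lemma rword_reduced w : exists2 t : (plen w).-tuple 'I_n.-1,
  rword w = Some t & reduced (map val t) w.
Proof.
have vt m (t : m.-tuple 'I_n.-1) : validw n (map val t).
  by apply/allP=> _ /mapP[[x hx] _ ->] /=; lia.
rewrite /rword; case: pickP => [t /eqP et|h].
  by exists t => //; split=> //; rewrite size_map size_tuple.
have [s [vs es ss]] := reduced_ex w.
have [t et] : exists t : (plen w).-tuple 'I_n.-1, map val t = s.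
  pose t' := pmap insub s : seq 'I_n.-1.
  have et : map val t' = s.
    rewrite /t' (pmap_filter (insubK _)); apply/all_filterP.
    by apply: sub_all vs => x hx; rewrite /= isSome_insub; lia.
  have st : size t' == plen w by rewrite -ss -et size_map.
  by exists (Tuple st).
by have := h t; rewrite et es eqxx.
Qed.

Section Tw.
Variables (R : nzRingType) (G : nat -> R).
Hypothesis brG : braided G.

Lemma Tw_reduced s w : reduced s w -> Tw G w = (\prod_(i <- s) G i)%R.
Proof.
move=> rs; rewrite /Tw; have [t -> rt] := rword_reduced w.
by rewrite -(matsumoto brG rt rs) big_map.
Qed.

Lemma Tw1 : Tw G (1%g : 'S_n) = 1%R.
Proof. by rewrite (@Tw_reduced [::]) ?big_nil //; split=> //; rewrite plen1. Qed.

Lemma Tw_right w i : i.+1 < n -> pv w i < pv w i.+1 ->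
  Tw G (sref n i * w)%g = (Tw G w * G i)%R.
Proof.
move=> hi aw; have [s rs] := reduced_ex w.
rewrite (Tw_reduced rs) (Tw_reduced (reduced_add_pv hi aw rs)).
by rewrite -cats1 big_cat big_seq1.
Qed.

Lemma Tw_left w i : i.+1 < n -> pv (w^-1)%g i < pv (w^-1)%g i.+1 ->
  Tw G (w * sref n i)%g = (G i * Tw G w)%R.
Proof.
move=> hi; rewrite -(ascE _ hi) => aw; have [s rs] := reduced_ex w.
by rewrite (Tw_reduced rs) (Tw_reduced (reduced_cons aw rs)) big_cons.
Qed.

End Tw.

Lemma perm_ind_pv (P : 'S_n -> Prop) : P 1%g ->
  (forall w i, i.+1 < n -> pv w i < pv w i.+1 -> P w -> P (sref n i * w)%g) ->
  forall w, P w.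
Proof.
by move=> P1 PS; apply: perm_ind_right => // w i hi; rewrite ascE; apply: PS.
Qed.

Lemma plen_pv w i : i.+1 < n -> pv w i < pv w i.+1 ->
  plen (sref n i * w)%g = (plen w).+1.
Proof. by move=> hi; rewrite -(ascE _ hi); apply: plen_asc. Qed.

Lemma pv_nasc w i : i.+1 < n -> ~~ (pv w i < pv w i.+1) -> pv w i.+1 < pv w i.
Proof.
by move=> hi; rewrite -leqNgt ltn_neqAle => ->; rewrite andbT; apply/eqP=> /pv_inj; lia.
Qed.

End Matsumoto.

(** * Young subgroups and Grassmannian permutations *)

Section Young.
Variables n k : nat.
Implicit Types (w u v : 'S_n) (i j : nat).
Local Open Scope nat_scope.

Lemma youngP v : reflect (forall i : 'I_n, (v i < k) = (i < k)) (young k v).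
Proof. exact: 'forall_eqP. Qed.

Lemma young1 : young k (1%g : 'S_n).
Proof. by apply/youngP => i; rewrite perm1. Qed.

Lemma youngM u v : young k u -> young k v -> young k (u * v)%g.
Proof. by move=> /youngP hu /youngP hv; apply/youngP=> i; rewrite permM hv hu. Qed.

Lemma youngV u : young k u -> young k (u^-1)%g.
Proof. by move=> /youngP hu; apply/youngP=> i; rewrite -hu permKV. Qed.

Lemma young_sref i : i.+1 < n -> i.+1 != k -> young k (sref n i).
Proof.
move=> hi ik; apply/youngP=> a; rewrite srefE //.
by case: eqP => [->|_]; [lia | case: eqP => [->|_]; lia].
Qed.

Lemma young_fix v : (forall i : 'I_n, i < k -> v i = i) -> young k v.
Proof.
move=> h; apply/youngP=> i; case: (ltnP i k) => hi; first by rewrite h.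
apply/negbTE/negP=> hv; have := h _ hv => /perm_inj e.
by move: hv; rewrite e ltnNge hi.
Qed.

Lemma pv_comp u v i (hi : i < n) : pv (u * v)%g i = pv v (pv u i).
Proof. by rewrite !(pvE _ hi) permM pv_ord. Qed.

(** A Young permutation keeps the first block below the second, so [i.+1 = k] never gives a descent,
    and removing a descent does not leave the subgroup. *)
Lemma young_ind (P : 'S_n -> Prop) : P 1%g ->
  (forall v i, i.+1 < n -> i.+1 != k -> young k v -> pv v i < pv v i.+1 ->
     P v -> P (sref n i * v)%g) ->
  forall v, young k v -> P v.
Proof.
move=> P1 PS; elim/perm_ind_pv=> // v i hi av IH ysv.
have ik : i.+1 != k.
  apply/eqP=> ik; have := asc_pv_sref v hi; rewrite av /= (pvE _ hi) (pvE _ (ltnW hi)).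
  have /= := youngP _ ysv (Ordinal hi); have /= := youngP _ ysv (Ordinal (ltnW hi)).
  by lia.
have yv : young k v by rewrite -(srefM_K i v) youngM // young_sref.
by apply: PS => //; apply: IH.
Qed.

(** The Grassmannian permutations, which are the minimal length representatives of the cosets of the
    Young subgroup. *)
Definition blockinc u := forall i, i.+1 < n -> i.+1 != k -> pv u i < pv u i.+1.

Lemma blockinc_lt u a b : blockinc u -> a < b -> b < n -> (a < k) = (b < k) ->
  pv u a < pv u b.
Proof.
move=> bu; elim: b => // b IH lab hb e.
have [->|nab] := eqVneq a b; first by apply: bu => //; lia.
apply: (@ltn_trans (pv u b)); last by apply: bu => //; lia.
by apply: IH; lia.
Qed.

(** Uniqueness of the Grassmannian representative: a descent of [v] lies inside a block, and [u],
    increasing on blocks, would turn it into a descent of [v * u] there. *)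
Lemma blockinc_young u v : blockinc u -> blockinc (v * u)%g -> young k v -> v = 1%g.
Proof.
move=> bu bvu /youngP yv; apply: no_desc => i hi; rewrite ascE.
rewrite ltnNge; apply/negP=> le.
have lt : pv v i.+1 < pv v i.
  by rewrite ltn_neqAle le andbT; apply/eqP=> /pv_inj; lia.
have := yv (Ordinal hi); have := yv (Ordinal (ltnW hi)); rewrite -!pv_ord /= => h1 h2.
have [ik|ik] := eqVneq i.+1 k; first by lia.
have := bvu i hi ik; rewrite !pv_comp //; last exact: ltnW.
have : pv u (pv v i.+1) < pv u (pv v i).
  apply: blockinc_lt => //; first by rewrite (pvE _ (ltnW hi)).
  by lia.
lia.
Qed.

Lemma blockinc_rep w : exists2 v, young k v & blockinc (v * w)%g.
Proof.
have [v yv vmin] := arg_minnP (fun v => plen (v * w)%g) young1.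
exists v => // i hi ik; case: (boolP (pv (v * w)%g i < pv (v * w)%g i.+1)) => // nd.
have := vmin (sref n i * v)%g (youngM (young_sref hi ik) yv); rewrite -mulgA.
by rewrite (plen_desc (hi := hi) (w := (v * w)%g)) ?ascE // ltnn.
Qed.

(** Lengths add in this factorization: an ascent of [v] inside a block remains an ascent of
    [v * u]. *)
Lemma Tw_young (R : nzRingType) (G : nat -> R) u v : braided n G ->
  blockinc u -> young k v -> (Tw G (v * u)%g = Tw G u * Tw G v)%R.
Proof.
move=> bG bu; elim/young_ind => [|{}v i hi ik yv av IH].
  by rewrite mul1g Tw1 // mulr1.
rewrite (Tw_right bG hi av) mulrA -IH -mulgA Tw_right //.
have hi' := ltnW hi; rewrite !pv_comp //; apply: blockinc_lt => //.
  by rewrite (pvE _ hi).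
have := youngP _ yv (Ordinal hi); have := youngP _ yv (Ordinal (ltnW hi)).
by rewrite -!pv_ord /= ; lia.
Qed.

Hypothesis lekn : k <= n.

Definition wlpred (l : part n k) u :=
  (forall j, j < k -> pv u j = nth 0 [seq val x | x <- l] (k.-1 - j) + j) /\
  (forall i j, k <= i -> i < j -> j < n -> pv u i < pv u j).

Lemma is_partP (l : part n k) :
  reflect (forall i j, i <= j -> j < k ->
    nth 0 [seq val x | x <- l] j <= nth 0 [seq val x | x <- l] i) (is_part l).
Proof.
have E (i : 'I_k) : nth 0 [seq val x | x <- l] i = tnth l i.
  by rewrite (nth_map ord0) ?size_tuple // -tnth_nth.
apply: (iffP forallP) => h i.
  move=> j lij hj; have hi := leq_ltn_trans lij hj.
  have /forallP/(_ (Ordinal hj)) := h (Ordinal hi); rewrite /= lij /=.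
  by rewrite -!E.
by apply/forallP=> j; apply/implyP=> lij; have := h i j lij (ltn_ord j); rewrite !E.
Qed.

Lemma part_bound (l : part n k) j : nth 0 [seq val x | x <- l] j <= n - k.
Proof.
case: (ltnP j k) => hj; last by rewrite nth_default // size_map size_tuple.
by rewrite (nth_map ord0) ?size_tuple // -ltnS ltn_ord.
Qed.

Lemma wlpred_blockinc (l : part n k) u : is_part l -> wlpred l u -> blockinc u.
Proof.
move=> /is_partP pl [h1 h2] i hi ik; case: (ltnP i k) => hik.
  have hik' : i.+1 < k by lia.
  rewrite !h1 //; have := pl (k.-1 - i.+1) (k.-1 - i); lia.
by apply: h2.
Qed.

Lemma wlpred_uniq (l : part n k) u u' : is_part l -> wlpred l u -> wlpred l u' -> u = u'.
Proof.
move=> pl hu hu'; have bu := wlpred_blockinc pl hu; have bu' := wlpred_blockinc pl hu'.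
have yv : young k (u * u'^-1)%g.
  apply: young_fix => i hi; rewrite permM; apply: (canLR (permK u')).
  by apply: ord_inj; rewrite -!pv_ord hu.1 // hu'.1.
have := blockinc_young (u := u') (v := (u * u'^-1)%g) bu'.
by rewrite mulgKV => /(_ bu yv)/eqP; rewrite -eq_mulgV1 => /eqP.
Qed.

Lemma wlpred_ex (l : part n k) : is_part l -> exists u, wlpred l u.
Proof.
move=> /is_partP pl.
pose F j := nth 0 [seq val x | x <- l] (k.-1 - j) + j.
(* One-line notation of the permutation: the prescribed first [k] values, then the remaining values
   in increasing order. *)
pose s1 := mkseq F k; pose s2 := [seq x <- iota 0 n | x \notin s1].
have Finc i j : i < j -> j < k -> F i < F j.
  by move=> lij hj; rewrite /F; have := pl (k.-1 - j) (k.-1 - i); lia.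
have Fn j : j < k -> F j < n.
  by move=> hj; rewrite /F; have := part_bound l (k.-1 - j); lia.
have us1 : uniq s1.
  apply/mkseq_uniqP=> i j; rewrite !inE => hi hj e.
  by case: (ltngtP i j) => // h; [have := Finc _ _ h hj | have := Finc _ _ h hi]; lia.
have sz1 : size s1 = k by rewrite size_mkseq.
have ps : perm_eq (s1 ++ s2) (iota 0 n).
  apply: uniq_perm; [|exact: iota_uniq|].
    rewrite cat_uniq us1 filter_uniq ?iota_uniq // andbT.
    by apply/hasPn=> x; rewrite mem_filter => /andP[].
  move=> x; rewrite mem_cat mem_filter mem_iota /= add0n.
  case: (boolP (x \in s1)) => //= /mapP[j]; rewrite mem_iota /= add0n => hj ->.
  by rewrite Fn.
have usz : uniq (s1 ++ s2) by rewrite (perm_uniq ps) iota_uniq.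
have sz : size (s1 ++ s2) = n by rewrite (perm_size ps) size_iota.
have fn (i : 'I_n) : nth 0 (s1 ++ s2) i < n.
  have : nth 0 (s1 ++ s2) i \in iota 0 n by rewrite -(perm_mem ps) mem_nth ?sz.
  by rewrite mem_iota.
pose f (i : 'I_n) := Ordinal (fn i).
have finj : injective f.
  by move=> i j [] /eqP; rewrite nth_uniq ?sz // => /eqP/ord_inj.
have E i : i < n -> pv (perm finj) i = nth 0 (s1 ++ s2) i.
  by move=> hi; rewrite (pvE _ hi) permE.
exists (perm finj); split=> [j hj|i j hi lij hj].
  by rewrite E ?(leq_trans hj) // nth_cat sz1 hj nth_mkseq.
rewrite !E ?(ltn_trans lij) // !nth_cat sz1 !ltnNge hi (leq_trans hi (ltnW lij)) /=.
have srt : sorted ltn s2 by apply: sorted_filter; [exact: ltn_trans | exact: iota_ltn_sorted].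
rewrite -ltnNge; have := sz; rewrite size_cat sz1 => sz2.
apply: (sorted_ltn_nth ltn_trans 0 srt); rewrite ?inE; lia.
Qed.

Lemma wlP (l : part n k) : is_part l -> wlpred l (wl l).
Proof.
move=> pl; rewrite /wl; case: pickP => [w /andP[/forallP h1 /forallP h2]|h] /=.
  split=> [j hj|i j hi lij hj].
    have hjn : j < n by apply: leq_trans hj lekn.
    by rewrite (pvE _ hjn); apply/eqP; have /= := h1 (Ordinal hjn); rewrite hj.
  have hin := ltn_trans lij hj.
  have /forallP/(_ (Ordinal hj)) := h2 (Ordinal hin).
  by rewrite /= hi lij /= (pvE _ hj) (pvE _ hin).
have [u [h1 h2]] := wlpred_ex pl.
move/negP: (negbT (h u)); case; apply/andP; split.
  by apply/forallP=> j; apply/implyP=> hj; rewrite -h1 // pv_ord.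
by apply/forallP=> i; apply/forallP=> j; apply/implyP=> /andP[hi lij];
  rewrite -!pv_ord; apply: h2.
Qed.

Lemma wl_blockinc (l : part n k) : is_part l -> blockinc (wl l).
Proof. by move=> pl; apply: wlpred_blockinc (wlP pl). Qed.

Lemma wl_ex u : blockinc u -> exists2 l : part n k, is_part l & wl l = u.
Proof.
move=> bu.
have lo j : j < k -> j <= pv u j.
  elim: j => // j IH hj; have := IH (ltnW hj); have := bu j; lia.
have hi_ d : forall j, j < k -> k = j + d.+1 -> pv u j + d < n.
  elim: d => [|d IH] j hj e.
    by rewrite addn0 pvE ?ltn_ord //; lia.
  have hj' : j.+1 < k by lia.
  by have := IH j.+1 hj'; have := bu j; lia.
have inc j : j.+1 < k -> pv u j - j <= pv u j.+1 - j.+1.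
  by move=> hj; have := bu j; have := lo j; lia.
have incs i j : i <= j -> j < k -> pv u i - i <= pv u j - j.
  elim: j => [|j IH] lij hj; first by have -> : i = 0 by lia.
  have [->//|nij] := eqVneq i j.+1.
  by apply: leq_trans (inc _ hj); apply: IH; lia.
have bound j : j < k -> pv u j - j < (n - k).+1.
  by move=> hj; have := hi_ (k.-1 - j) j hj; have := lo j hj; lia.
(* The parts are the excesses [pv u j - j], read from [j = k.-1] downwards. By [lo] the subtraction
   is exact, and by [bound] the value fits, so [inord] does not change it. *)
pose l : part n k := [tuple inord (pv u (k.-1 - j) - (k.-1 - j)) | j < k].
have El j : j < k -> nth 0 [seq val x | x <- l] j = pv u (k.-1 - j) - (k.-1 - j).
  move=> hj; rewrite (nth_map ord0) ?size_tuple //.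
  rewrite -(tnth_nth ord0 l (Ordinal hj)) tnth_mktuple /= inordK //.
  by apply: bound; lia.
have pl : is_part l.
  by apply/is_partP=> i j lij hj; rewrite !El //; [apply: incs; lia | lia].
exists l => //; apply: (wlpred_uniq pl (wlP pl)); split=> [j hj|i j hi lij hj].
  by rewrite El; [have := lo j hj; have -> : k.-1 - (k.-1 - j) = j by [lia]; lia | lia].
by apply: (blockinc_lt bu); lia.
Qed.

Lemma wl_inj (l l' : part n k) : is_part l -> is_part l' -> wl l = wl l' -> l = l'.
Proof.
move=> pl pl' e; apply: eq_from_tnth => i.
have [h _] := wlP pl; have [h' _] := wlP pl'.
have hi : k.-1 - i < k by have := ltn_ord i; lia.
have ei : k.-1 - (k.-1 - i) = i by have := ltn_ord i; lia.
have := h _ hi; rewrite e h' // ei => /eqP; rewrite eqn_add2r.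
have E (m : part n k) : nth 0 [seq val x | x <- m] i = tnth m i.
  by rewrite (nth_map ord0) ?size_tuple // -tnth_nth.
by rewrite !E => /eqP/ord_inj.
Qed.

Lemma wl_coset_inj (l l' : part n k) : is_part l -> is_part l' ->
  young k (wl l * (wl l')^-1)%g -> l = l'.
Proof.
move=> pl pl' y; apply: wl_inj => //.
have := blockinc_young (wl_blockinc pl') _ y.
by rewrite mulgKV => /(_ (wl_blockinc pl))/eqP; rewrite -eq_mulgV1 => /eqP.
Qed.

Lemma sum_young (A : nmodType) (F : 'S_n -> A) :
  (\sum_w F w = \sum_(l : part n k | is_part l) \sum_(v | young k v) F (Defs.pcomp (wl l) v))%R.
Proof.
pose l0 : part n k := nseq_tuple k ord0.
(* [w * (wl l)^-1] is the candidate for the Young factor [v]. By [GrP] the pick succeeds, so the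
   value of [l0] does not matter. *)
pose Gr w := odflt l0 [pick l : part n k | is_part l && young k (w * (wl l)^-1)%g].
have GrP w : is_part (Gr w) && young k (w * (wl (Gr w))^-1)%g.
  rewrite /Gr; case: pickP => //= h.
  have [v yv /wl_ex[l pl e]] := blockinc_rep w.
  by have := h l; rewrite pl e invMg mulgA mulgV mul1g youngV.
have GrE w l : is_part l -> (Gr w == l) = young k (w * (wl l)^-1)%g.
  move=> pl; have /andP[pG yG] := GrP w; apply/eqP/idP => [<- //|yl].
  apply: wl_coset_inj => //.
  have -> : (wl (Gr w) * (wl l)^-1 = (w * (wl (Gr w))^-1)^-1 * (w * (wl l)^-1))%g.
    by rewrite invMg invgK -mulgA mulKg.
  by rewrite youngM // youngV.
rewrite (partition_big Gr (@is_part n k)) => [|w _]; last by case/andP: (GrP w).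
apply: eq_bigr => l pl; rewrite (reindex_inj (mulIg (wl l))) /=.
by apply: eq_bigl => v; rewrite GrE // mulgK.
Qed.

(** An inversion of a Young permutation joins two positions of one block, and [dd] counts all such
    pairs. This keeps the exponent [dd n k - plen v] in [Sigma] from being truncated. *)
Lemma plen_young v : young k v -> plen v <= dd n k.
Proof.
(* [lo b] is the first position of the block that contains [b]. *)
move=> /youngP yv; pose lo (b : nat) := if b < k then 0 else k.
pose B := [set x : 'I_n * 'I_n | lo x.2 <= x.1 < x.2].
apply: (@leq_trans #|B|).
  apply/subset_leq_card/subsetP=> -[a b]; rewrite !inE /= /lo => /andP[lab lv].
  by have := yv a; have := yv b; case: ifP; lia.
have cnt (b : 'I_n) : \sum_(a < n | lo b <= a < b) 1 = b - lo b.
  rewrite -[RHS]muln1 -sum_nat_const_nat (big_nat_widen _ _ n); last exact: ltnW.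
  by rewrite big_geq_mkord; apply: eq_bigl => a; rewrite /= andbC.
have -> : #|B| = \sum_(b < n) (b - lo b).
  rewrite -sum1_card (eq_bigl (fun x : 'I_n * 'I_n => lo x.2 <= x.1 < x.2)); last first.
    by move=> x; rewrite inE.
  rewrite -(pair_big_dep xpredT (fun a b : 'I_n => lo b <= a < b) (fun _ _ => 1)) /=.
  by rewrite (exchange_big_dep xpredT) //=; apply: eq_bigr => b _; rewrite cnt.
rewrite -(big_mkord xpredT (fun b => b - lo b)) (big_cat_nat (n := k)) //= /dd -!bin2_sum.
rewrite leq_eqVlt; apply/orP; left; apply/eqP; congr (_ + _).
  by apply: eq_big_nat => i /= hi; rewrite /lo hi subn0.
rewrite -{1}[k]add0n big_addn; apply: eq_big_nat => i _.
by rewrite /lo ltnNge leq_addl /= addnK.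
Qed.

End Young.

(** * The affine Hecke algebra *)

Section Evaluation.
Variables (n : nat) (H : algType Ah) (X : nat -> H).
Implicit Types f g : {mpoly Ah[n]}.

Lemma heval0 : heval X (0 : {mpoly Ah[n]}) = 0.
Proof. exact: (mmap0 _ (GRing.in_alg H)). Qed.

Lemma hevalD f g : heval X (f + g) = heval X f + heval X g.
Proof. exact: (mmapD _ (GRing.in_alg H)). Qed.

Lemma hevalB f g : heval X (f - g) = heval X f - heval X g.
Proof. exact: (mmapB _ (GRing.in_alg H)). Qed.

Lemma hevalC c : heval X (c%:MP : {mpoly Ah[n]}) = c%:A.
Proof. exact: (mmapC _ (GRing.in_alg H)). Qed.

Lemma hevalZ c f : heval X (c *: f) = c *: heval X f.
Proof. by rewrite -[RHS]mulr_algl; exact: (mmapZ _ (GRing.in_alg H)). Qed.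

Lemma hevalXm m : heval X ('X_[m] : {mpoly Ah[n]}) = mmap1 (fun i : 'I_n => X i) m.
Proof. exact: (mmapX _ (GRing.in_alg H)). Qed.

Lemma hevalX (i : 'I_n) : heval X ('X_i : {mpoly Ah[n]}) = X i.
Proof. by rewrite hevalXm mmap1U. Qed.

Lemma heval_sum I (r : seq I) (P : pred I) (F : I -> {mpoly Ah[n]}) :
  heval X (\sum_(i <- r | P i) F i) = \sum_(i <- r | P i) heval X (F i).
Proof. exact: (raddf_sum (mmap (GRing.in_alg H) _)). Qed.

Hypothesis Xcomm : forall i j, (i < n)%N -> (j < n)%N -> X i * X j = X j * X i.

(** [H] is not commutative. Multiplicativity rests on the images of the variables commuting, which
    settles monomials; linearity does the rest. *)
Lemma hevalM f g : heval X (f * g) = heval X f * heval X g.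
Proof.
have prodM (r : seq 'I_n) (m1 m2 : 'X_{1..n}) :
    \prod_(i <- r) X i ^+ (m1 + m2)%MM i
    = (\prod_(i <- r) X i ^+ m1 i) * (\prod_(i <- r) X i ^+ m2 i).
  elim: r => [|i r IH]; first by rewrite !big_nil mulr1.
  rewrite !big_cons IH mnmDE exprD -!mulrA; congr (_ * _); rewrite !mulrA.
  congr (_ * _); apply: commr_prod => j _.
  by apply: commrX; apply: commr_sym; apply: commrX; apply: Xcomm.
have XmM m1 m2 : heval X ('X_[m1] * 'X_[m2] : {mpoly Ah[n]})
    = heval X 'X_[m1] * heval X 'X_[m2] by rewrite -mpolyXD !hevalXm /mmap1 prodM.
have XM m g' : heval X ('X_[m] * g') = heval X 'X_[m] * heval X g'.
  elim/mpolyind: g' => [|c m' p _ _ IH]; first by rewrite mulr0 heval0 mulr0.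
  by rewrite mulrDr !hevalD -scalerAr !hevalZ XmM IH mulrDr scalerAr.
elim/mpolyind: f => [|c m' p _ _ IH]; first by rewrite mul0r heval0 mul0r.
by rewrite mulrDl !hevalD -scalerAl !hevalZ XM IH mulrDl scalerAl.
Qed.

End Evaluation.

Section Hecke.
Variables (n : nat) (H : algType Ah) (T X : nat -> H).
Hypothesis rel : hecke_rel n T X.
Implicit Types (w u v : 'S_n) (i j : nat).

Lemma hecke_Xcomm i j : (i < n)%N -> (j < n)%N -> X i * X j = X j * X i.
Proof. by case: rel => _ [_ [_ [h _]]]; apply: h. Qed.

Lemma T_sqr i : (i.+1 < n)%N -> T i * T i = (qq - pp) *: T i + (pp * qq)%:A.
Proof.
move=> hi; case: rel => /(_ i hi) + _.
rewrite mulrDl !mulrBr !mulr_algl !mulr_algr scalerA => /eqP.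
rewrite addrA subr_eq0 => /eqP e.
by rewrite -e scalerBl addrC addrA subrK addrC subrK.
Qed.

Lemma Tbar_sqr i : (i.+1 < n)%N ->
  Tbar T i * Tbar T i = (pp - qq) *: Tbar T i + (pp * qq)%:A.
Proof.
move=> hi; rewrite {1}/Tbar mulrDl mulr_algl addrC; congr (_ + _).
rewrite /Tbar mulrDr mulr_algr T_sqr // addrAC -scalerDl.
by rewrite addrA subrK subrr scale0r add0r.
Qed.

(** By [e3], which expands with the quadratic relation of the outer factor, the braid product of the
    shifted generators differs from that of the [T i] by terms symmetric in the two generators. *)
Lemma Tbar_braided : braided n (Tbar T).
Proof.
have [_ [hc [hb _]]] := rel; split=> [i j hi hj hij|i hi].
  rewrite /Tbar !mulrDl !mulrDr !mulr_algl !mulr_algr hc //.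
  by rewrite -!addrA; congr (_ + _); rewrite !addrA; congr (_ + _); rewrite addrC.
set c := pp - qq.
have e3 a b : (a + c%:A) * (a + c%:A) = c *: (a + c%:A) + (pp * qq)%:A ->
    (a + c%:A) * (b + c%:A) * (a + c%:A)
    = a * b * a + (c *: (a * b + b * a) + (c *: (c *: (a + b + c%:A))
        + c *: (pp * qq)%:A)) :> H.
  move=> sq; rewrite [(a + c%:A) * (b + _)]mulrDr mulr_algr [LHS]mulrDl -scalerAl sq.
  rewrite [(a + _) * b]mulrDl mulr_algl [_ * (a + _)]mulrDl -scalerAl !(mulrDr, mulr_algr).
  rewrite -!addrA !scalerDr -!addrA; congr (_ + (_ + (_ + _))).
  exact: addrCA.
have hi' := ltnW hi.
rewrite /Tbar !e3; [|exact: Tbar_sqr..].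
by rewrite hb // [T i.+1 * T i + T i * _]addrC [T i.+1 + T i]addrC.
Qed.

End Hecke.

(** The twisted Leibniz rule of divided differences: [g'] and [h'] stand for the images of [g] and
    [h] under [s_i], and [z] for the difference of the two exchanged variables. *)
Lemma divided_diff_mul (R : comNzRingType) (z c g g' D h h' E : R) :
  z * D = c * (g - g') -> z * E = c * (h - h') ->
  z * (g' * E + D * h) = c * (g * h - g' * h').
Proof. by move=> e1 e2; rewrite mulrDr mulrCA e2 mulrA e1; ring. Qed.

Lemma divided_diff_inv (R : idomainType) (z c g D : R) :
  z != 0 -> z * D = c * (g - g) -> D = 0.
Proof. by move=> z0; rewrite subrr mulr0 => /eqP; rewrite mulf_eq0 (negbTE z0) => /eqP. Qed.

(** * Moving polynomials to the left of the [T_i] *)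

Section Straightening.
Variable n : nat.
Implicit Types (f g h : {mpoly Ah[n]}) (i : nat) (w u v : 'S_n).

Lemma msymXU (s : 'S_n) (a : 'I_n) : msym s ('X_a : {mpoly Ah[n]}) = 'X_(s a).
Proof. by rewrite /msym mmapX mmap1U. Qed.

(* [D] is a multiple of the divided difference of [g]; the first equation
   determines it and shows that it vanishes when [g] is [s_i]-invariant. *)
Definition straight i (hi : (i.+1 < n)%N) g D :=
  ('X_(Ordinal (ltnW hi)) - 'X_(Ordinal hi)) * D
    = (hb%:MP - (pp - qq) *: 'X_(Ordinal (ltnW hi))) * (g - msym (sref n i) g) /\
  forall (H : algType Ah) (T X : nat -> H), hecke_rel n T X ->
    T i * heval X g = heval X (msym (sref n i) g) * T i + heval X D.

Lemma straightD i (hi : (i.+1 < n)%N) g D h E :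
  straight hi g D -> straight hi h E -> straight hi (g + h) (D + E).
Proof.
move=> [e1 r1] [e2 r2]; split=> [|H T X rel].
  by rewrite msymD mulrDr e1 e2 -mulrDr opprD addrACA.
by rewrite msymD !hevalD mulrDr (r1 _ _ _ rel) (r2 _ _ _ rel) mulrDl addrACA.
Qed.

Lemma straightM i (hi : (i.+1 < n)%N) g D h E :
  straight hi g D -> straight hi h E ->
  straight hi (g * h) (msym (sref n i) g * E + D * h).
Proof.
move=> [e1 r1] [e2 r2]; split=> [|H T X rel].
  by rewrite msymM; have := divided_diff_mul e1 e2.
have Xc := hecke_Xcomm rel.
rewrite msymM hevalD !(hevalM Xc) mulrA (r1 _ _ _ rel) mulrDl -(mulrA _ (T i)) (r2 _ _ _ rel).
by rewrite mulrDr -!mulrA addrA.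
Qed.

Lemma straightC i (hi : (i.+1 < n)%N) c : straight hi c%:MP 0.
Proof.
have e : msym (sref n i) (c%:MP : {mpoly Ah[n]}) = c%:MP by rewrite /msym mmapC.
split=> [|H T X rel]; rewrite e; first by rewrite subrr !mulr0.
by rewrite heval0 addr0 !hevalC mulr_algl mulr_algr.
Qed.

Lemma straightX i (hi : (i.+1 < n)%N) (a : 'I_n) : exists D, straight hi 'X_a D.
Proof.
set D := hb%:MP - (pp - qq) *: 'X_(Ordinal (ltnW hi)).
have [-> | ni] := eqVneq a (Ordinal (ltnW hi)).
  exists D; split=> [|H T X rel]; rewrite msymXU sref_l -/D; first by rewrite mulrC.
  have [_ [_ [_ [_ [_ [h _]]]]]] := rel.
  by rewrite hevalB hevalC hevalZ !hevalX /= h.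
have [-> | nj] := eqVneq a (Ordinal hi).
  exists (- D); split=> [|H T X rel]; rewrite msymXU sref_r -/D.
    by rewrite mulrN mulrC -mulrN opprB.
  have [_ [_ [_ [_ [_ [_ h]]]]]] := rel.
  by rewrite -sub0r hevalB heval0 sub0r hevalB hevalC hevalZ !hevalX /= h.
exists 0; have sa : sref n i a = a.
  by rewrite (sref_tperm hi) tpermD // eq_sym.
split=> [|H T X rel]; rewrite msymXU sa; first by rewrite subrr !mulr0.
have [_ [_ [_ [_ [h _]]]]] := rel.
by rewrite heval0 addr0 !hevalX h //; [move/eqP: ni | move/eqP: nj] => + e; apply; apply: ord_inj.
Qed.

Lemma straight_ex i (hi : (i.+1 < n)%N) g : exists D, straight hi g D.
Proof.
elim/mpolyind: g => [|c m p _ _ [E hE]].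
  by exists 0; rewrite -mpolyC0; apply: straightC.
have [D hD] : exists D, straight hi 'X_[m] D.
  rewrite mpolyXE_id; elim/big_ind: _ => [|x y [D hD] [D' hD']|a _].
  - by exists 0; rewrite -mpolyC1; apply: straightC.
  - by exists (msym (sref n i) x * D' + D * y); apply: straightM.
  elim: (m a) => [|d [D' hD']].
    by exists 0; rewrite expr0 -mpolyC1; apply: straightC.
  have [D hD] := straightX hi a.
  by exists (msym (sref n i) 'X_a * D' + D * 'X_a ^+ d); rewrite exprS; apply: straightM.
eexists; rewrite -mul_mpolyC; apply: straightD hE.
by apply: straightM hD; apply: straightC.
Qed.

Lemma T_invariant i g (H : algType Ah) (T X : nat -> H) : (i.+1 < n)%N ->
  hecke_rel n T X -> msym (sref n i) g = g -> T i * heval X g = heval X g * T i.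
Proof.
move=> hi rel sg; have [D [e r]] := straight_ex hi g.
suff D0 : D = 0 by rewrite (r _ _ _ rel) sg D0 heval0 addr0.
rewrite sg in e.
suff nz : 'X_(Ordinal (ltnW hi)) - 'X_(Ordinal hi) != 0 :> {mpoly Ah[n]}.
  exact: (@divided_diff_inv {mpoly Ah[n]} _ _ _ _ nz e).
rewrite subr_eq0; apply/eqP=> /(congr1 (mcoeff U_(Ordinal hi))) /eqP.
have ne : (Ordinal (ltnW hi) == Ordinal hi) = false.
  by apply/eqP=> -[] /eqP; rewrite ltn_eqF.
by rewrite !mcoeffXU eqxx ne eq_sym oner_eq0.
Qed.

Lemma Tbar_straight i g : (i.+1 < n)%N -> exists E : {mpoly Ah[n]},
  forall (H : algType Ah) (T X : nat -> H), hecke_rel n T X ->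
    Tbar T i * heval X g = heval X (msym (sref n i) g) * Tbar T i + heval X E.
Proof.
move=> hi; have [D [_ r]] := straight_ex hi g.
exists (D + (pp - qq) *: (g - msym (sref n i) g)) => H T X rel.
rewrite /Tbar mulrDl mulrDr (r _ _ _ rel) mulr_algl mulr_algr hevalD hevalZ hevalB scalerBr.
by rewrite -!addrA; congr (_ + _); rewrite addrCA; congr (_ + _); rewrite addrC subrK.
Qed.

Lemma Tw_Tbar (H : algType Ah) (T X : nat -> H) u i : hecke_rel n T X -> (i.+1 < n)%N ->
  Tw (Tbar T) u * Tbar T i =
    (if (pv u i < pv u i.+1)%N then 0 else pp - qq) *: Tw (Tbar T) u +
    (if (pv u i < pv u i.+1)%N then 1 else pp * qq) *: Tw (Tbar T) (sref n i * u)%g.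
Proof.
move=> rel hi; have br := Tbar_braided rel.
case: ifP => au; first by rewrite scale0r add0r scale1r Tw_right.
have e : Tw (Tbar T) u = Tw (Tbar T) (sref n i * u)%g * Tbar T i.
  by rewrite -Tw_right // ?srefM_K // asc_pv_sref // au.
by rewrite {1}e -mulrA (Tbar_sqr rel) // mulrDr mulr_algr -scalerAr -e.
Qed.

(** The order of quantifiers matters: the coefficients are fixed before the algebra, so the same
    ones hold in the generic model and in every Schubert representation. *)
Lemma Tw_expand g w : exists c : 'S_n -> {mpoly Ah[n]},
  forall (H : algType Ah) (T X : nat -> H), hecke_rel n T X ->
    Tw (Tbar T) w * heval X g = \sum_u heval X (c u) * Tw (Tbar T) u.
Proof.
elim/perm_ind_pv: w g => [|w i hi aw IH] g.
  exists (fun u => if u == 1%g then g else 0) => H T X rel.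
  rewrite (bigD1 1%g) //= eqxx Tw1 ?mul1r ?mulr1; last exact: Tbar_braided rel.
  by rewrite big1 ?addr0 // => u /negbTE ->; rewrite heval0 mul0r.
have [E rE] := Tbar_straight g hi.
have [c1 h1] := IH (msym (sref n i) g); have [c2 h2] := IH E.
pose a u : Ah := if (pv u i < pv u i.+1)%N then 0 else pp - qq.
pose b u : Ah := if (pv u i < pv u i.+1)%N then 1 else pp * qq.
(* After right multiplication by [Tbar T i], the term of [u] is fed by the old terms of [u] (weight
   [a]) and of [sref n i * u] (weight [b]); [c2] comes from the correction [E]. *)
exists (fun u => a u *: c1 u + b (sref n i * u)%g *: c1 (sref n i * u)%g + c2 u).
move=> H T X rel; rewrite (Tw_right (Tbar_braided rel) hi aw) -mulrA (rE _ _ _ rel).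
rewrite mulrDr mulrA (h1 _ _ _ rel) (h2 _ _ _ rel) mulr_suml.
rewrite [X in X + _ = _](eq_bigr (fun u =>
    a u *: heval X (c1 u) * Tw (Tbar T) u
    + b u *: heval X (c1 u) * Tw (Tbar T) (sref n i * u)%g)); last first.
  move=> u _; rewrite -mulrA (Tw_Tbar _ rel hi) mulrDr -/(a u) -/(b u).
  by rewrite -!scalerAr !scalerAl.
rewrite big_split /= [X in _ + X + _](reindex_inj (mulgI (sref n i))) /=.
rewrite -!big_split /=; apply: eq_bigr => u _.
by rewrite !hevalD !hevalZ srefM_K !mulrDl.
Qed.

End Straightening.

(** * The Young symmetrizer and existence of the expansion *)

Section Symmetrizer.
Variables (n k : nat).
Hypothesis lekn : (k <= n)%N.
Variables (H : algType Ah) (T X : nat -> H).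
Hypothesis rel : hecke_rel n T X.
Implicit Types (u v w : 'S_n) (i : nat).

Let br := Tbar_braided rel.

Lemma Tbar_Tw v i : (i.+1 < n)%N ->
  Tbar T i * Tw (Tbar T) v =
    (if (pv v^-1 i < pv v^-1 i.+1)%N then 0 else pp - qq) *: Tw (Tbar T) v +
    (if (pv v^-1 i < pv v^-1 i.+1)%N then 1 else pp * qq) *: Tw (Tbar T) (v * sref n i)%g.
Proof.
move=> hi; case: ifP => av; first by rewrite scale0r add0r scale1r Tw_left.
have e : Tw (Tbar T) v = Tbar T i * Tw (Tbar T) (v * sref n i)%g.
  rewrite -(@Tw_left n) // -?mulgA ?srefK ?mulg1 //.
  by rewrite invMg srefV asc_pv_sref // av.
by rewrite {1}e mulrA (Tbar_sqr rel) // mulrDl mulr_algl -scalerAl -e.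
Qed.

(** [Sigma] without its normalising factor, so that it makes sense where [[k]![n-k]!] is not
    invertible. *)
Definition symmetrizer : H :=
  \sum_(v : 'S_n | young k v) (qq ^+ (dd n k - plen v))%:A * Tw (Tbar T) v.

(** The powers of [q] are tuned for this eigenvalue. Pair [v] with [s_i v] and put [e = d - l(v)]:
    the new coefficient of [Tbar_v] is [p q q^(e-1)] if [s_i v] is longer and
    [(p - q) q^e + q^(e+1)] if it is shorter, that is, [p q^e] in both cases. *)
Lemma Tbar_symmetrizer i : (i.+1 < n)%N -> i.+1 != k ->
  Tbar T i * symmetrizer = pp *: symmetrizer.
Proof.
move=> hi ik; pose a v : Ah := if (pv v^-1 i < pv v^-1 i.+1)%N then 0 else pp - qq.
pose b v : Ah := if (pv v^-1 i < pv v^-1 i.+1)%N then 1 else pp * qq.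
pose e v := qq ^+ (dd n k - plen v).
rewrite /symmetrizer mulr_sumr scaler_sumr.
rewrite (eq_bigr (fun v => (a v * e v) *: Tw (Tbar T) v
    + (b v * e v) *: Tw (Tbar T) (v * sref n i)%g)); last first.
  move=> v yv; rewrite mulr_algl -scalerAr Tbar_Tw // scalerDr !scalerA.
  by rewrite !(mulrC _ (e v)).
have ysv v : young k (v * sref n i)%g = young k v.
  apply/idP/idP => y; last by rewrite youngM // young_sref.
  by rewrite -[v](mulgK (sref n i)) srefV youngM // young_sref.
rewrite big_split /= [X in _ + X](reindex_inj (mulIg (sref n i))) /=.
rewrite [X in _ + X](eq_bigl (young k)) // -big_split /=; apply: eq_bigr => v yv.
rewrite -mulgA srefK mulg1 -scalerDl mulr_algl scalerA; congr (_ *: _).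
have yv' : young k (v * sref n i)%g by rewrite ysv.
rewrite /a /b /e invMg srefV asc_pv_sref //.
have lv := plen_young lekn yv; have lv' := plen_young lekn yv'.
have pl u : plen u = plen (u^-1)%g by rewrite plenV.
case: (boolP (pv _ _ < _)%N) => /= av.
  have e1 : plen (v * sref n i)%g = (plen v).+1.
    by rewrite pl invMg srefV plen_pv // -pl.
  have -> : (dd n k - plen v = (dd n k - plen (v * sref n i)%g).+1)%N by lia.
  by rewrite exprS mul0r add0r mulrA.
have e1 : plen v = (plen (v * sref n i)%g).+1.
  by rewrite pl (plen_desc (hi := hi)) ?ascE // pl invMg invgK srefV.
have -> : (dd n k - plen (v * sref n i)%g = (dd n k - plen v).+1)%N by lia.
by rewrite exprS mul1r -mulrDl subrK.
Qed.

Lemma Tw_symmetrizer v : young k v ->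
  Tw (Tbar T) v * symmetrizer = pp ^+ plen v *: symmetrizer.
Proof.
elim/young_ind => [|{}v i hi ik yv av IH]; first by rewrite Tw1 // mul1r plen1 scale1r.
rewrite Tw_right // -mulrA Tbar_symmetrizer // -scalerAr IH scalerA.
by rewrite plen_pv // exprS.
Qed.

Section Bisymmetric.
Variable f : {mpoly Ah[n]}.
Hypothesis fsym : bisym k f.

Lemma Tw_bisym v : young k v ->
  Tw (Tbar T) v * heval X f = heval X f * Tw (Tbar T) v.
Proof.
elim/young_ind => [|{}v i hi ik yv av IH]; first by rewrite Tw1 // mul1r mulr1.
rewrite Tw_right // [RHS]mulrA -IH -!mulrA; congr (_ * _).
rewrite /Tbar mulrDl mulrDr mulr_algl mulr_algr; congr (_ + _).
by apply: (T_invariant hi rel); apply: fsym; apply: young_sref.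
Qed.

Lemma symmetrizer_bisym : symmetrizer * heval X f = heval X f * symmetrizer.
Proof.
rewrite /symmetrizer mulr_suml mulr_sumr; apply: eq_bigr => v yv.
by rewrite !mulr_algl -scalerAl -scalerAr Tw_bisym.
Qed.

(** This sum links the two parts of the theorem: [p^l(v)] is the eigenvalue of [Tbar_v] on the
    symmetrizer, and also the weight of [Y_(w_l v)] in [Y_l]. *)
Definition coset_coef (Q : 'S_n -> {mpoly Ah[n]}) (l : part n k) : {mpoly Ah[n]} :=
  \sum_(v | young k v) pp ^+ plen v *: Q (Defs.pcomp (wl l) v).

Lemma Tw_symmetrizer_expand w Q :
  Tw (Tbar T) w * heval X f = \sum_u heval X (Q u) * Tw (Tbar T) u ->
  Tw (Tbar T) w * symmetrizer * heval X f
  = \sum_(l : part n k | is_part l)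
      heval X (coset_coef Q l) * (Tw (Tbar T) (wl l) * symmetrizer).
Proof.
move=> eQ; rewrite -mulrA symmetrizer_bisym mulrA eQ mulr_suml (sum_young lekn).
apply: eq_bigr => l pl; rewrite /coset_coef heval_sum mulr_suml; apply: eq_bigr => v yv.
rewrite /Defs.pcomp (Tw_young br (wl_blockinc lekn pl) yv) -!mulrA Tw_symmetrizer //.
by rewrite hevalZ -!scalerAl -!scalerAr.
Qed.

End Bisymmetric.
End Symmetrizer.

Lemma inv_scalar_comm (H : algType Ah) (c : Ah) (ci x : H) :
  ci * c%:A = 1 -> ci * x = x * ci.
Proof.
rewrite mulr_algr => h; transitivity (c *: (ci * x * ci)).
  by rewrite scalerAr h mulr1.
by rewrite -mulrA scalerAl h mul1r.
Qed.

Lemma expansion_ex (n k : nat) (f : {mpoly Ah[n]}) : (k <= n)%N -> bisym k f ->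
  exists P : part n k -> part n k -> {mpoly Ah[n]}, expansion f P.
Proof.
move=> lekn fsym; have [Q hQ] := fin_all_exists (Tw_expand f).
exists (fun l mu => coset_coef (Q (wl mu)) l) => H T X ci rel h1 h2 mu pmu.
rewrite /Tlam /Sigma -/(symmetrizer n k T).
have cc x : ci * x = x * ci by apply: inv_scalar_comm h1.
have TS w : Tw (Tbar T) w * (ci * symmetrizer n k T)
    = ci * (Tw (Tbar T) w * symmetrizer n k T) by rewrite mulrA -cc mulrA.
rewrite TS -mulrA (Tw_symmetrizer_expand lekn rel fsym (hQ _ _ _ _ rel)) mulr_sumr.
by apply: eq_bigr => l pl; rewrite TS mulrA [RHS]mulrA cc.
Qed.

(** * Endomorphism algebras of Hecke modules *)

(* [endalg phi pV] is [End(V)] with composition as product, made an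
   [Ah]-algebra through [phi]; [pV] only serves to make it nontrivial. *)
Definition endalg (F : fieldType) (phi : {rmorphism Ah -> F}) (V : vectType F)
  (pV : (0 < dim V)%N) : Type := 'End(V).

Section EndAlgebra.
Variables (F : fieldType) (phi : {rmorphism Ah -> F}) (V : vectType F).
Variable (pV : (0 < dim V)%N).
Local Notation E := (endalg phi pV).

HB.instance Definition _ := GRing.Zmodule.copy E 'End(V).

HB.instance Definition _ := GRing.Zmodule_isNzRing.Build E
  (@comp_lfunA _ _ _ _ _) (@comp_lfun1l _ _ _) (@comp_lfun1r _ _ _)
  (@comp_lfunDl _ _ _ _) (@comp_lfunDr _ _ _ _) (lfun1_neq0 pV).

Definition endalg_scale (a : Ah) (x : E) : E := (phi a *: (x : 'End(V)))%VF.

Fact endalg_scaleA a b x : endalg_scale a (endalg_scale b x) = endalg_scale (a * b) x.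
Proof. by rewrite /endalg_scale scalerA rmorphM. Qed.
Fact endalg_scale1 : left_id 1 endalg_scale.
Proof. by move=> x; rewrite /endalg_scale rmorph1 scale1r. Qed.
Fact endalg_scaleDr : right_distributive endalg_scale +%R.
Proof. by move=> a x y; rewrite /endalg_scale scalerDr. Qed.
Fact endalg_scaleDl x : {morph endalg_scale^~ x : a b / a + b}.
Proof. by move=> a b; rewrite /endalg_scale rmorphD scalerDl. Qed.

HB.instance Definition _ := GRing.Zmodule_isLmodule.Build Ah E
  endalg_scaleA endalg_scale1 endalg_scaleDr endalg_scaleDl.

Fact endalg_scaleAl (a : Ah) (x y : E) : a *: (x * y) = (a *: x) * y.
Proof. exact: comp_lfunZl. Qed.
HB.instance Definition _ := GRing.Lmodule_isLalgebra.Build Ah E endalg_scaleAl.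

Fact endalg_scaleAr (a : Ah) (x y : E) : a *: (x * y) = x * (a *: y).
Proof. exact: comp_lfunZr. Qed.
HB.instance Definition _ := GRing.Lalgebra_isAlgebra.Build Ah E endalg_scaleAr.

Definition eapp (x : E) (v : V) : V := (x : 'End(V)) v.

Lemma eappP (x y : E) : eapp x =1 eapp y -> x = y.
Proof. by move=> h; apply/lfunP. Qed.

Lemma eapp_mul (x y : E) v : eapp (x * y) v = eapp x (eapp y v).
Proof. exact: comp_lfunE. Qed.

Lemma eapp1 v : eapp 1 v = v.
Proof. exact: id_lfunE. Qed.

Lemma eapp0 v : eapp 0 v = 0.
Proof. exact: zero_lfunE. Qed.

Lemma eappD (x y : E) v : eapp (x + y) v = eapp x v + eapp y v.
Proof. exact: add_lfunE. Qed.

Lemma eappB (x y : E) v : eapp (x - y) v = eapp x v - eapp y v.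
Proof. by rewrite eappD; congr (_ + _); exact: opp_lfunE. Qed.

Lemma eappZ (a : Ah) (x : E) v : eapp (a *: x) v = phi a *: eapp x v.
Proof. exact: scale_lfunE. Qed.

Lemma eappA (a : Ah) v : eapp a%:A v = phi a *: v.
Proof. by rewrite eappZ eapp1. Qed.

Lemma eappDr (x : E) u v : eapp x (u + v) = eapp x u + eapp x v.
Proof. exact: linearD. Qed.

Lemma eappZr (x : E) a v : eapp x (a *: v) = a *: eapp x v.
Proof. exact: linearZ. Qed.

Lemma eapp_sumr (x : E) I (r : seq I) (P : pred I) (G : I -> V) :
  eapp x (\sum_(i <- r | P i) G i) = \sum_(i <- r | P i) eapp x (G i).
Proof. exact: linear_sum. Qed.

Lemma eapp_sum I (r : seq I) (P : pred I) (G : I -> E) v :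
  eapp (\sum_(i <- r | P i) G i) v = \sum_(i <- r | P i) eapp (G i) v.
Proof. exact: sum_lfunE. Qed.

(** It represents [f] only if [f] is linear, which [hecke_action] grants for indices in range; this
    is why [eTE] and [eXE] carry bounds. *)
Definition elift (f : V -> V) : E := linfun f.

Lemma eliftE (f : V -> V) : (forall a u v, f (a *: u + v) = a *: f u + f v) ->
  eapp (elift f) =1 f.
Proof.
move=> lf; pose g : {linear V -> V} := HB.pack f (GRing.isLinear.Build _ _ _ _ f lf).
exact: (lfunE g).
Qed.

End EndAlgebra.

Section Action.
Variables (n : nat) (F : fieldType) (phi : {rmorphism Ah -> F}) (V : vectType F).
Variables (pV : (0 < dim V)%N) (T X : nat -> V -> V).
Hypothesis act : hecke_action n phi T X.
Implicit Types (i : nat) (w : 'S_n) (f : {mpoly Ah[n]}).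

Definition eT i : endalg phi pV := elift phi pV (T i).
Definition eX i : endalg phi pV := elift phi pV (X i).

Lemma eTE i : (i.+1 < n)%N -> eapp (eT i) =1 T i.
Proof. by case: act => h _ hi; apply: eliftE => a u v; apply: h. Qed.

Lemma eXE i : (i < n)%N -> eapp (eX i) =1 X i.
Proof. by case: act => _ [h _] hi; apply: eliftE => a u v; apply: h. Qed.

Lemma endalg_rel : hecke_rel n eT eX.
Proof.
case: act => [_ [_ [h1 [h2 [h3 [h4 [h5 [h6 h7]]]]]]]].
split=> [i hi|]; [|split=> [i j hi hj hij|]; [|split=> [i hi|]; [|split=> [i j hi hj|];
  [|split=> [i j hi hj n1 n2|]; [|split=> i hi]]]]]; apply: eappP => v.
- by rewrite eapp_mul eappD eappB !eappA eapp0 !eTE // h1.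
- by rewrite !eapp_mul !eTE // h2.
- by have hi' := ltnW hi; rewrite !eapp_mul !eTE // h3.
- by rewrite !eapp_mul !eXE // h4.
- by rewrite !eapp_mul !eTE // !eXE // h5.
- have hi' := ltnW hi; rewrite eappD eappB eappA eappZ !eapp_mul !eTE // !eXE //.
  by rewrite h6.
- have hi' := ltnW hi; rewrite eappB eappB eappA eappZ !eapp_mul !eTE // !eXE //.
  by rewrite h7.
Qed.

Lemma opw_eapp w v : opw T w v = eapp (Tw eT w) v.
Proof.
rewrite /opw /Tw; case: (rword w) => [t|]; last by rewrite eapp1.
elim: (tval t) => [|i s IH]; first by rewrite big_nil eapp1.
by rewrite big_cons eapp_mul eTE /= -?IH //; case: i => i /=; lia.
Qed.

Lemma opeval_eapp f v : opeval phi X f v = eapp (heval eX f) v.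
Proof.
rewrite /opeval /heval /mmap eapp_sum; apply: eq_bigr => m _.
rewrite eapp_mul eappA; congr (_ *: _).
rewrite /opmono /mmap1 enumT [index_enum _]unlock.
elim: (Finite.enum _) => [|i s IH]; first by rewrite big_nil eapp1.
rewrite big_cons eapp_mul /= IH; elim: (m i) => [|d IHd]; first by rewrite expr0 eapp1.
by rewrite exprS eapp_mul eXE //= IHd.
Qed.

Section Functional.
Variables (t : nat -> F) (ev : V -> F).
Hypothesis ev_lin : forall a u v, ev (a *: u + v) = a * ev u + ev v.
Hypothesis ev_X : forall i v, (i < n)%N -> ev (X i v) = t i * ev v.

Lemma ev0 : ev 0 = 0.
Proof. by have := ev_lin (-1) 0 0; rewrite scaler0 addr0 mulN1r addNr. Qed.

Lemma evD u v : ev (u + v) = ev u + ev v.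
Proof. by rewrite -[u in LHS]scale1r ev_lin mul1r. Qed.

Lemma evZ a u : ev (a *: u) = a * ev u.
Proof. by rewrite -[a *: u]addr0 ev_lin ev0 addr0. Qed.

Lemma ev_sum I (r : seq I) (P : pred I) (G : I -> V) :
  ev (\sum_(i <- r | P i) G i) = \sum_(i <- r | P i) ev (G i).
Proof. by apply: (big_morph ev); [exact: evD | exact: ev0]. Qed.

Lemma ev_heval f v :
  ev (eapp (heval eX f) v) = mmap phi (fun i : 'I_n => t i) f * ev v.
Proof.
rewrite /heval /mmap eapp_sum ev_sum mulr_suml; apply: eq_bigr => m _.
rewrite eapp_mul eappA evZ -mulrA; congr (_ * _).
rewrite /mmap1; elim: (index_enum _) => [|i s IH]; first by rewrite !big_nil eapp1 mul1r.
rewrite !big_cons eapp_mul -mulrA -IH; elim: (m i) => [|d IHd].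
  by rewrite !expr0 eapp1 mul1r.
by rewrite !exprS eapp_mul (eXE (ltn_ord i)) (ev_X _ (ltn_ord i)) IHd mulrA.
Qed.

End Functional.
End Action.

(** * The generic principal series *)

Section Demazure.
Variables (F : fieldType) (p q h : F).

(* [T = A s + B] solves the cross relation [T x = y T + (h - (p - q) x)] with [T 1 = q]. *)
Definition dlA (x y : F) := (p * x - q * y - h) / (x - y).
Definition dlB (x y : F) := (h - (p - q) * x) / (x - y).

(** With [b] and [a] the values of a function at [w] and at [sref n i * w], this is the quadratic
    relation at the point [w]. *)
Lemma dl_quad x y a b : x != y ->
  dlA x y * (dlA y x * b + dlB y x * a - q * a)
    + dlB x y * (dlA x y * a + dlB x y * b - q * b)
    + p * (dlA x y * a + dlB x y * b - q * b) = 0.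
Proof.
by move=> nxy; rewrite /dlA /dlB; field; rewrite !subr_eq0 nxy eq_sym nxy.
Qed.

Lemma dl_braid x y z a1 a2 a3 a4 a5 a6 : x != y -> y != z -> x != z ->
  dlA x y * (dlA x z * (dlA y z * a6 + dlB y z * a5) + dlB x z * (dlA y x * a1 + dlB y x * a2))
  + dlB x y * (dlA y z * (dlA x z * a4 + dlB x z * a3) + dlB y z * (dlA x y * a2 + dlB x y * a1))
  = dlA y z * (dlA x z * (dlA x y * a6 + dlB x y * a4) + dlB x z * (dlA z y * a1 + dlB z y * a3))
  + dlB y z * (dlA x y * (dlA x z * a5 + dlB x z * a2) + dlB x y * (dlA y z * a3 + dlB y z * a1)).
Proof.
move=> nxy nyz nxz; rewrite /dlA /dlB; field.
have nyx : y != x by rewrite eq_sym.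
have nzy : z != y by rewrite eq_sym.
have nzx : z != x by rewrite eq_sym.
by rewrite !subr_eq0 ?nxy ?nyz ?nxz ?nyx ?nzy ?nzx.
Qed.

(** The cross relation for [x_i] at one point, in the same notation; [dl_X'] is the one for
    [x_(i+1)]. *)
Lemma dl_X x y a b : x != y ->
  dlA x y * (y * a) + dlB x y * (x * b)
  = y * (dlA x y * a + dlB x y * b) + (h * b - (p - q) * (x * b)).
Proof. by move=> nxy; rewrite /dlA /dlB; field; rewrite subr_eq0. Qed.

Lemma dl_X' x y a b : x != y ->
  dlA x y * (x * a) + dlB x y * (y * b)
  = x * (dlA x y * a + dlB x y * b) - (h * b - (p - q) * (x * b)).
Proof. by move=> nxy; rewrite /dlA /dlB; field; rewrite subr_eq0. Qed.

End Demazure.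

Section Generic.
Variables (n : nat) (F : fieldType) (phi : {rmorphism Ah -> F}) (t : nat -> F).
Hypothesis t_inj : forall i j, (i < n)%N -> (j < n)%N -> i <> j -> t i != t j.

(** The space of the principal series. Below, [gX i] is diagonal with eigenvalue [t (w i)] at [w],
    and [gT i] mixes the values at [w] and [sref n i * w]; distinct parameters keep the denominators
    nonzero. *)
Definition gV : vectType F := {ffun 'S_n -> F^o}.
Implicit Types (w u v : 'S_n) (i : nat) (psi : gV).

Local Notation A := (dlA (phi pp) (phi qq) (phi hb)).
Local Notation B := (dlB (phi pp) (phi qq) (phi hb)).

Definition gX i (psi : gV) : gV := [ffun w => t (pv w i) * (psi : {ffun _ -> _}) w : F^o].
Definition gT i (psi : gV) : gV := [ffun w =>
  A (t (pv w i)) (t (pv w i.+1)) * (psi : {ffun _ -> _}) (sref n i * w)%g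
  + B (t (pv w i)) (t (pv w i.+1)) * (psi : {ffun _ -> _}) w : F^o].

Definition gapp (psi : gV) (w : 'S_n) : F := (psi : {ffun _ -> _}) w.

Lemma gappP psi psi' : gapp psi =1 gapp psi' -> psi = psi'.
Proof. by move=> e; apply/ffunP. Qed.

Lemma gappD psi psi' w : gapp (psi + psi') w = gapp psi w + gapp psi' w.
Proof. by rewrite /gapp ffunE. Qed.
Lemma gappN psi w : gapp (- psi) w = - gapp psi w.
Proof. by rewrite /gapp ffunE. Qed.
Lemma gappZ a psi w : gapp (a *: psi) w = a * gapp psi w.
Proof. by rewrite /gapp ffunE. Qed.
Lemma gapp0 w : gapp 0 w = 0.
Proof. by rewrite /gapp ffunE. Qed.
Lemma gappX i psi w : gapp (gX i psi) w = t (pv w i) * gapp psi w.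
Proof. by rewrite /gapp ffunE. Qed.
Lemma gappT i psi w : gapp (gT i psi) w =
  A (t (pv w i)) (t (pv w i.+1)) * gapp psi (sref n i * w)%g
  + B (t (pv w i)) (t (pv w i.+1)) * gapp psi w.
Proof. by rewrite /gapp ffunE. Qed.

Let gappE := (gappD, gappN, gappZ, gappX, gappT, gapp0).

Lemma pv_lt w i : (i < n)%N -> (pv w i < n)%N.
Proof. by move=> hi; rewrite (pvE _ hi). Qed.

Lemma t_pv_neq w i j : (i < n)%N -> (j < n)%N -> i <> j -> t (pv w i) != t (pv w j).
Proof. by move=> hi hj ij; apply: t_inj; [exact: pv_lt..|move/pv_inj=> /(_ hi hj)]. Qed.

Lemma pv_sref_l w i : (i.+1 < n)%N -> pv (sref n i * w)%g i = pv w i.+1.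
Proof. by move=> hi; rewrite pv_sref // eqxx. Qed.
Lemma pv_sref_r w i : (i.+1 < n)%N -> pv (sref n i * w)%g i.+1 = pv w i.
Proof. by move=> hi; rewrite pv_sref // eqxx; case: eqP => //; lia. Qed.
Lemma pv_sref_o w i j : (i.+1 < n)%N -> j <> i -> j <> i.+1 ->
  pv (sref n i * w)%g j = pv w j.
Proof. by move=> hi /eqP/negbTE ni /eqP/negbTE nj; rewrite pv_sref // ni nj. Qed.

Lemma g_action : hecke_action n phi gT gX.
Proof.
split; first by move=> i a u v hi; apply: gappP => w; rewrite !gappE; ring.
split; first by move=> i a u v hi; apply: gappP => w; rewrite !gappE; ring.
split.
  move=> i v hi; apply: gappP => w; have hi' := ltnW hi.
  rewrite !gappE pv_sref_l // pv_sref_r // srefM_K.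
  by apply: dl_quad; apply: t_pv_neq => //; lia.
split.
  move=> i j v hi hj hij; apply: gappP => w.
  rewrite !gappE !(@pv_sref_o _ i) ?(@pv_sref_o _ j) //; try lia.
  have -> : (sref n j * (sref n i * w) = sref n i * (sref n j * w))%g.
    by rewrite !mulgA; case: hij => hij; rewrite (sref_comm _ _ hij).
  by ring.
split.
  move=> i v hi; apply: gappP => w; have hi' := ltnW hi; have hi'' := ltnW hi'.
  rewrite !gappE !srefM_K !(pv_sref_l, pv_sref_r) //.
  rewrite !(@pv_sref_o _ i i.+2) ?(@pv_sref_o _ i.+1 i) //; try lia.
  rewrite !(pv_sref_l, pv_sref_r) //.
  have -> : (sref n i * (sref n i.+1 * (sref n i * w))
      = sref n i.+1 * (sref n i * (sref n i.+1 * w)))%g.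
    by rewrite !mulgA sref_braid.
  (* The six values in [dl_braid] are those of [v] on the orbit of [w] under [s_i] and [s_(i+1)]:
     [a1] at [w], [a6] at the opposite end, which the preceding rewriting makes the same on both
     sides. *)
  by apply: dl_braid; apply: t_pv_neq => //; lia.
split.
  by move=> i j v hi hj; apply: gappP => w; rewrite !gappE; ring.
split.
  move=> i j v hi hj n1 n2; apply: gappP => w; rewrite !gappE pv_sref_o //; ring.
split.
  move=> i v hi; apply: gappP => w; have hi' := ltnW hi; rewrite !gappE pv_sref_l // rmorphB.
  by apply: dl_X; apply: t_pv_neq => //; lia.
move=> i v hi; apply: gappP => w; have hi' := ltnW hi; rewrite !gappE pv_sref_r // rmorphB.
by apply: dl_X'; apply: t_pv_neq => //; lia.
Qed.

End Generic.

Lemma dim_gt0 (F : fieldType) (V : vectType F) (v : V) : v != 0 -> (0 < dim V)%N.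
Proof.
rewrite -dimvf lt0n dimv_eq0; apply: contraNN => /eqP e.
by rewrite -memv0 -e memvf.
Qed.

(** * Linear independence of the [Tbar_w] over the polynomials *)

Section Independence.
Variables (n : nat) (F : fieldType) (phi : {rmorphism Ah -> F}) (t : nat -> F).
Hypothesis t_inj : forall i j, (i < n)%N -> (j < n)%N -> i <> j -> t i != t j.
Hypothesis t_num : forall i j, (i < n)%N -> (j < n)%N -> i <> j ->
  phi pp * t i - phi qq * t j - phi hb != 0.
Variable pV : (0 < dim (gV n F))%N.
Implicit Types (w u v : 'S_n) (i : nat) (psi : gV n F).

Let act := g_action phi t_inj.
Local Notation gTe := (eT phi pV (@gT n F phi t)).
Local Notation gXe := (eX phi pV (@gX n F t)).

Definition gev psi : F := gapp psi 1%g.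

Lemma gev_lin a psi psi' : gev (a *: psi + psi') = a * gev psi + gev psi'.
Proof. by rewrite /gev gappD gappZ. Qed.

Lemma gev_X i psi : (i < n)%N -> gev (gX t i psi) = t i * gev psi.
Proof. by move=> hi; rewrite /gev gappX (pvE _ hi) perm1. Qed.

(** Triangularity: each letter shifts the support by at most one step in length, and the leading
    coefficient is a product of values of [dlA], whose numerators are nonzero by [t_num]. *)
Lemma gev_Tw w : exists2 a : F, a != 0 & forall psi,
  (forall u, (plen u < plen w)%N -> gapp psi u = 0) ->
  gev (eapp (Tw (Tbar gTe) w) psi) = a * gapp psi w.
Proof.
have br := Tbar_braided (endalg_rel pV act).
elim/perm_ind_pv: w => [|w i hi aw [a a0 IH]].
  by exists 1; rewrite ?oner_eq0 // => psi _; rewrite Tw1 // eapp1 mul1r.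
have hi' := ltnW hi.
set A := dlA (phi pp) (phi qq) (phi hb) (t (pv w i)) (t (pv w i.+1)).
exists (a * A).
  rewrite mulf_neq0 // /A /dlA mulf_neq0 //.
    apply: t_num; [exact: pv_lt..|]; by move/pv_inj; lia.
  by rewrite invr_neq0 // subr_eq0; apply: t_pv_neq => //; lia.
move=> psi h0; rewrite (plen_pv hi aw) in h0.
rewrite (Tw_right br hi aw) eapp_mul IH => [|u lu];
  rewrite /Tbar eappD eappA (eTE pV act) // gappD gappZ gappT.
  by rewrite -/A (h0 w) // !mulr0 !addr0 mulrA.
rewrite (h0 u) ?(ltn_trans lu) // h0 ?mulr0 ?addr0 //.
exact: leq_ltn_trans (plen_sref_le _ hi) _.
Qed.

Lemma Tw_indep (c : 'S_n -> {mpoly Ah[n]}) :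
  \sum_w heval gXe (c w) * Tw (Tbar gTe) w = 0 ->
  forall w, mmap phi (fun i : 'I_n => t i) (c w) = 0.
Proof.
move=> e0; set m := mmap phi _.
have e psi : \sum_w m (c w) * gev (eapp (Tw (Tbar gTe) w) psi) = 0.
  have := congr1 (fun x => gev (eapp x psi)) e0.
  rewrite eapp_sum (ev_sum gev_lin) eapp0 (ev0 gev_lin) => ev_e.
  rewrite -[RHS]ev_e; apply: eq_bigr => w _.
  by rewrite eapp_mul (ev_heval pV act gev_lin gev_X).
move=> w1; apply/eqP; apply: contraT => nz1.
(* Test the relation on the indicator of a longest [w] with nonzero coefficient: by triangularity,
   every other permutation that is not longer contributes zero. *)
have [w nz wmax] := arg_maxnP (P := fun w => m (c w) != 0) (@plen n) nz1.
pose psi : gV n F := [ffun u => (u == w)%:R : F^o].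
have psiE u : gapp psi u = (u == w)%:R by rewrite /gapp ffunE.
have [a a0 ha] := gev_Tw w.
have := e psi; rewrite (bigD1 w) //= big1 => [|u nu].
  rewrite ha => [|u lu]; last by rewrite psiE; case: eqP => // eu; move: lu; rewrite eu ltnn.
  move/eqP; rewrite psiE eqxx mulr1 addr0 mulf_eq0 (negbTE a0) orbF => /eqP mw.
  by move: nz; rewrite mw eqxx.
have [->|nzu] := eqVneq (m (c u)) 0; first by rewrite mul0r.
have [b b0 hb'] := gev_Tw u.
rewrite hb' => [|z lz]; first by rewrite psiE (negbTE nu) !mulr0.
rewrite psiE; case: eqP => // ez; have := wmax u nzu; rewrite -ez => /leq_ltn_trans /(_ lz).
by rewrite ltnn.
Qed.

End Independence.

(** Take as parameters the variables themselves, inside the fractions of the polynomial ring: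
    evaluation is then the canonical embedding. Indices out of range get the default [0]. *)
Lemma generic_field (R : idomainType) (n : nat) :
  exists (F : fieldType) (phi : {rmorphism R -> F}) (t : nat -> F),
    forall c : {mpoly R[n]}, mmap phi (fun i : 'I_n => t i) c = 0 -> c = 0.
Proof.
pose K : fieldType := {fraction {mpoly R[n]}}.
pose iota : {rmorphism {mpoly R[n]} -> K} := @tofrac _.
exists K, (iota \o @mpolyC n R), (fun i => if insub i is Some a then iota 'X_(a : 'I_n) else 0).
move=> c; have -> : mmap (iota \o @mpolyC n R)
    (fun i : 'I_n => if insub (val i) is Some a then iota 'X_(a : 'I_n) else 0) c = iota c.
  elim/mpolyind: c => [|a m p _ _ IH]; first by rewrite mmap0 rmorph0.
  rewrite mmapD mmapZ mmapX IH rmorphD -mul_mpolyC rmorphM /=; congr (_ * _ + _).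
  rewrite mpolyXE_id rmorph_prod; apply: eq_bigr => i _.
  by rewrite valK rmorphXn.
by move=> /eqP; rewrite tofrac_eq0 => /eqP.
Qed.

Lemma mpolyXU_neq0 n (R : nzRingType) (i : 'I_n) : 'X_i != 0 :> {mpoly R[n]}.
Proof.
by apply/eqP=> /(congr1 (mcoeff U_(i))) /eqP; rewrite mcoeffXU eqxx mcoeff0 oner_eq0.
Qed.

Lemma mpolyZ_eq0 n (R : idomainType) (c : R) (p : {mpoly R[n]}) :
  c *: p = 0 -> c != 0 -> p = 0.
Proof.
move=> e c0; apply/mpolyP=> m; have /eqP := congr1 (mcoeff m) e.
by rewrite mcoeffZ mcoeff0 mulf_eq0 (negbTE c0) => /eqP.
Qed.

Lemma qnum_neq0 m : (0 < m)%N -> qnum m != 0.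
Proof.
(* At [p = q = 1] a quantum number becomes the ordinary integer. *)
case: m => // m _; apply/eqP => /(congr1 (meval (fun _ => 1 : rat))).
rewrite /qnum rmorph_sum rmorph0 (eq_bigr (fun _ => 1)) => [|i _] /=; last first.
  by rewrite rmorphM !rmorphXn /= !mevalXU !expr1n mulr1.
by rewrite sumr_const card_ord => /eqP; rewrite Num.Theory.pnatr_eq0.
Qed.

Lemma qfact_neq0 m : qfact m != 0.
Proof.
rewrite /qfact big_add1 /= big_mkord; apply/prodf_neq0 => i _.
exact: qnum_neq0.
Qed.

(** * Uniqueness of the expansion coefficients *)

Section Coefficients.
Variables (n k : nat) (f : {mpoly Ah[n]}).
Hypotheses (lekn : (k <= n)%N) (fsym : bisym k f).
Variable Q : 'S_n -> 'S_n -> {mpoly Ah[n]}.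
Hypothesis hQ : forall w (H : algType Ah) (T X : nat -> H), hecke_rel n T X ->
  Tw (Tbar T) w * heval X f = \sum_u heval X (Q w u) * Tw (Tbar T) u.

(** Coordinates, on the [Tbar_w], of the combination of the [Tbar_(w_l) symmetrizer] with
    coefficients [D l]; this is the form to which linear independence applies. *)
Definition coset_spread (D : part n k -> {mpoly Ah[n]}) w : {mpoly Ah[n]} :=
  \sum_(l : part n k | is_part l && young k (w * (wl l)^-1)%g)
    qq ^+ (dd n k - plen (w * (wl l)^-1)%g) *: D l.

Lemma coset_spreadE (H : algType Ah) (T X : nat -> H) D : hecke_rel n T X ->
  \sum_w heval X (coset_spread D w) * Tw (Tbar T) w
  = \sum_(l | is_part l) heval X (D l) * (Tw (Tbar T) (wl l) * symmetrizer n k T).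
Proof.
move=> rel; have br := Tbar_braided rel.
rewrite (eq_bigr (fun w => \sum_(l : part n k | is_part l)
    if young k (w * (wl l)^-1)%g then
      qq ^+ (dd n k - plen (w * (wl l)^-1)%g) *: (heval X (D l) * Tw (Tbar T) w)
    else 0)); last first.
  move=> w _; rewrite /coset_spread heval_sum mulr_suml -big_mkcondr /=.
  by apply: eq_bigr => l' _; rewrite hevalZ scalerAl.
rewrite exchange_big /=; apply: eq_bigr => l' pl'.
rewrite (reindex_inj (mulIg (wl l'))) /= /symmetrizer !mulr_sumr [RHS]big_mkcond.
apply: eq_bigr => v _; rewrite mulgK; case: ifP => // yv.
by rewrite (Tw_young br (wl_blockinc lekn pl') yv) mulr_algl -!scalerAr.
Qed.

(** Writing [S] for the symmetrizer, expand [Tbar_(w_mu) Tbar_v' S f] in two ways: through [Q] for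
    the permutation [w_mu v'], or by letting [S] absorb [Tbar_v'] into [p^l(v')] and using [P]. *)
Lemma expansion_defect (P : part n k -> part n k -> {mpoly Ah[n]})
    (H : algType Ah) (T X : nat -> H) (ci : H) (mu : part n k) (v' : 'S_n) :
  expansion f P -> hecke_rel n T X ->
  ci * (qfact k * qfact (n - k))%:A = 1 -> (qfact k * qfact (n - k))%:A * ci = 1 ->
  is_part mu -> young k v' ->
  \sum_w heval X (coset_spread (fun l =>
      coset_coef (Q (Defs.pcomp (wl mu) v')) l - pp ^+ plen v' *: P l mu) w)
    * Tw (Tbar T) w = 0.
Proof.
move=> expP rel ci1 ci2 pmu yv'; have br := Tbar_braided rel.
pose S := symmetrizer n k T; set c := qfact k * _ in ci1 ci2.
have cc x : ci * x = x * ci by apply: inv_scalar_comm ci1.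
have expS : Tw (Tbar T) (wl mu) * S * heval X f
    = \sum_(l : part n k | is_part l) heval X (P l mu) * (Tw (Tbar T) (wl l) * S).
  have TS w : Tw (Tbar T) w * (ci * S) = ci * (Tw (Tbar T) w * S).
    by rewrite mulrA -cc mulrA.
  have := expP _ T X ci rel ci1 ci2 mu pmu; rewrite /Tlam /Sigma -/S TS.
  (* Multiplying by [c] cancels [ci] and passes from [Sigma] back to the symmetrizer. *)
  move=> /(congr1 (fun x => c%:A * x)); rewrite -(mulrA ci) (mulrA c%:A ci) ci2 mul1r => ->.
  rewrite mulr_sumr; apply: eq_bigr => l' _.
  by rewrite -/S TS [heval _ _ * _]mulrA -cc -(mulrA ci) (mulrA c%:A ci) ci2 mul1r.
rewrite (coset_spreadE _ rel) -/S.
rewrite (eq_bigr (fun l => heval X (coset_coef (Q (Defs.pcomp (wl mu) v')) l)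
      * (Tw (Tbar T) (wl l) * S)
      - pp ^+ plen v' *: (heval X (P l mu) * (Tw (Tbar T) (wl l) * S)))); last first.
  by move=> l' _; rewrite hevalB hevalZ mulrBl scalerAl.
rewrite sumrB -scaler_sumr -expS -(Tw_symmetrizer_expand lekn rel fsym (hQ _ rel)).
rewrite /Defs.pcomp (Tw_young br (wl_blockinc lekn pmu) yv').
by rewrite -!mulrA (mulrA _ S) (Tw_symmetrizer lekn rel yv') -scalerAl -!scalerAr subrr.
Qed.

(** Proved in the generic model, but an identity of polynomials, hence valid after specialization to
    any field. *)
Lemma expansion_coef (P : part n k -> part n k -> {mpoly Ah[n]}) :
  expansion f P -> forall (l mu : part n k) (v' : 'S_n),
  is_part l -> is_part mu -> young k v' ->
  coset_coef (Q (Defs.pcomp (wl mu) v')) l = pp ^+ plen v' *: P l mu.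
Proof.
move=> expP l mu v' pl pmu yv'.
have [F [phi [t minj]]] := generic_field Ah n.
set m := mmap phi _ in minj.
have mE (c : {mpoly Ah[n]}) : c != 0 -> m c != 0.
  by move=> c0; apply/eqP => /minj e; rewrite e eqxx in c0.
have mX i (hi : (i < n)%N) : m 'X_(Ordinal hi) = t i by rewrite /m mmapX mmap1U.
have mC a : m a%:MP = phi a by rewrite /m mmapC.
have XneX i j (hi : (i < n)%N) (hj : (j < n)%N) : i <> j ->
    ('X_(Ordinal hi) : {mpoly Ah[n]})@_U_(Ordinal hj) = 0.
  by move=> ij; rewrite mcoeffXU; case: eqP => // -[].
have t_inj i j : (i < n)%N -> (j < n)%N -> i <> j -> t i != t j.
  move=> hi hj ij; rewrite -subr_eq0 -(mX _ hi) -(mX _ hj) /m -mmapB; apply: mE.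
  apply/eqP => /(congr1 (mcoeff U_(Ordinal hi))) /eqP.
  by rewrite mcoeffB mcoeff0 (XneX _ _ hj hi) => [|/esym //]; rewrite mcoeffXU eqxx subr0 oner_eq0.
have [pp0 qq0] := (mpolyXU_neq0 rat (inord 0 : 'I_3), mpolyXU_neq0 rat (inord 1 : 'I_3)).
rewrite -/pp -/qq in pp0 qq0.
(* This is the value of a polynomial in which the variable of index [i] has coefficient [pp], since
   [i <> j]. *)
have t_num i j : (i < n)%N -> (j < n)%N -> i <> j ->
    phi pp * t i - phi qq * t j - phi hb != 0.
  move=> hi hj ij.
  have -> : phi pp * t i - phi qq * t j - phi hb
      = m (pp *: 'X_(Ordinal hi) - qq *: 'X_(Ordinal hj) - hb%:MP).
    by rewrite /m !mmapB !mmapZ -/m !mX mC.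
  apply: mE; apply/eqP => /(congr1 (mcoeff U_(Ordinal hi))) /eqP.
  rewrite !mcoeffB !mcoeffZ mcoeff0 (XneX _ _ hj hi) => [|/esym //].
  by rewrite mcoeffXU eqxx mcoeffC mnm1_eq0 !mulr0 !subr0 mulr1 (negbTE pp0).
have pV : (0 < dim (gV n F))%N.
  apply: (@dim_gt0 _ _ ([ffun=> 1] : {ffun 'S_n -> F^o})).
  by apply/eqP => /ffunP/(_ 1%g) /eqP; rewrite !ffunE oner_eq0.
have rel := endalg_rel pV (g_action phi t_inj).
(* [expansion] speaks of algebras where this scalar is invertible. Here evaluation is injective, so
   its image in [F] is nonzero. *)
pose c := qfact k * qfact (n - k).
have c0 : phi c != 0.
  by rewrite -mC; apply: mE; rewrite mpolyC_eq0 mulf_neq0 ?qfact_neq0.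
pose ci : endalg phi pV := ((phi c)^-1 *: (\1%VF : 'End(gV n F)))%R.
have ciE v : eapp ci v = (phi c)^-1 *: v.
  by rewrite /eapp /ci scale_lfunE id_lfunE.
have ci1 : ci * c%:A = 1.
  by apply: eappP => v; rewrite eapp_mul eappA ciE scalerA mulVf // scale1r eapp1.
have ci2 : c%:A * ci = 1.
  by apply: eappP => v; rewrite eapp_mul eappA ciE scalerA mulfV // scale1r eapp1.
(* At the permutation [wl l] only the summand [l] survives, with trivial Young factor; its weight
   [qq ^+ dd n k] is nonzero and cancels. *)
have := Tw_indep t_inj t_num (expansion_defect expP rel ci1 ci2 pmu yv') (wl l).
rewrite -/m => /minj; rewrite /coset_spread (big_pred1 l) => [|l'].
  rewrite mulgV plen1 subn0 => /mpolyZ_eq0 e; apply/eqP; rewrite -subr_eq0; apply/eqP.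
  by apply: e; apply: expf_neq0.
apply/andP/eqP => [[pl' y]|->]; first by apply/esym/(wl_coset_inj lekn pl pl').
by rewrite mulgV young1.
Qed.

End Coefficients.

(** * Schubert representations *)

Section Schubert.
Variables (n : nat) (F : fieldType) (phi : {rmorphism Ah -> F}) (t : nat -> F).
Variables (V : vectType F) (T X : nat -> V -> V) (Y0 : V) (ev : V -> F).
Hypothesis rep : schubert_rep n phi t T X Y0 ev.
Implicit Types (u v w : 'S_n) (i : nat).

Local Notation Y := (@Ysch n V T Y0).

Let act : hecke_action n phi T X. Proof. by case: rep. Qed.

Lemma sch_ev_lin a (x y : V) : ev (a *: x + y) = a * ev x + ev y.
Proof. by case: rep => _ [_ [h _]]; apply: h. Qed.

Lemma sch_ev1 : ev (Y 1%g) != 0.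
Proof. by case: rep => _ [_ [_ [-> _]]]. Qed.

Lemma sch_decomp (v : V) : exists a : 'S_n -> F, v = \sum_w a w *: Y w.
Proof.
case: rep => _ [/andP[/eqP sp _] _].
have : v \in (\sum_(w : 'S_n) <[Y w]>)%VS.
  by rewrite -big_enum -(big_map Y xpredT (fun y => <[y]>%VS)) -span_def sp memvf.
case/memv_sumP => vs hvs ->.
have /fin_all_exists[a ha] w : exists a, vs w = a *: Y w by apply/vlineP/hvs.
by exists a; apply: eq_bigr => w _.
Qed.

Lemma sch_ev_X i (v : V) : (i < n)%N -> ev (X i v) = t i * ev v.
Proof.
move=> hi; case: rep => [[_ [lX _]] [_ [_ [_ h]]]].
have [a ->] := sch_decomp v; rewrite (ev_sum sch_ev_lin) mulr_sumr.
have X0 : X i 0 = 0.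
  by have := lX i (-1) 0 0 hi; rewrite scaler0 addr0 scaleN1r addNr.
have XD x y : X i (x + y) = X i x + X i y by rewrite -[x in LHS]scale1r lX // scale1r.
rewrite (big_morph (X i) XD X0) (ev_sum sch_ev_lin); apply: eq_bigr => w _.
by rewrite -[a w *: _ in LHS]addr0 lX // X0 addr0 !(evZ sch_ev_lin) h // mulrCA.
Qed.

Lemma sch_dim : (0 < dim V)%N.
Proof.
apply: (@dim_gt0 _ _ (Y 1%g)); apply: contraTneq sch_ev1 => ->.
by rewrite (ev0 sch_ev_lin) eqxx.
Qed.

Let pV := sch_dim.
Local Notation eT := (eT phi pV T).
Local Notation eX := (eX phi pV X).

Let rel : hecke_rel n eT eX := endalg_rel pV act.

Lemma T_braided : braided n eT.
Proof. by case: rel => _ [h1 [h2 _]]; split. Qed.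

(** [w0] reverses the order, so a descent of [w] at [i] is a place where [s_i] lengthens [w^-1 w0]
    from the left. *)
Lemma Y_desc w i : (i.+1 < n)%N -> (pv w i.+1 < pv w i)%N ->
  eapp (eT i) (Y w) = Y (sref n i * w)%g.
Proof.
move=> hi dw; rewrite /Ysch /Defs.pcomp !(opw_eapp pV act) -eapp_mul.
rewrite invMg srefV mulgA Tw_left //; first exact: T_braided.
have w0K (a : 'I_n) : ((w0 n)^-1 a)%g = rev_ord a.
  by apply: (canLR (permK _)); rewrite permE rev_ordK.
rewrite invMg invgK (pvE _ hi) (pvE _ (ltnW hi)) !permM !w0K /= -!pv_ord /=.
by have := pv_lt w hi; have := pv_lt w (ltnW hi); lia.
Qed.

(** At an ascent [Y w] is itself [T_i] of [Y (sref n i * w)], and [Tbar_i T_i = p q] leaves no term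
    in [Y w]. *)
Lemma Tbar_Y w i : (i.+1 < n)%N -> eapp (Tbar eT i) (Y w) =
  (if (pv w i < pv w i.+1)%N then phi (pp * qq) else 1) *: Y (sref n i * w)%g
  + (if (pv w i < pv w i.+1)%N then 0 else phi (pp - qq)) *: Y w.
Proof.
move=> hi; case: ifP => aw; last first.
  by rewrite scale1r /Tbar eappD eappA Y_desc // pv_nasc // aw.
have e : Y w = eapp (eT i) (Y (sref n i * w)%g).
  by rewrite Y_desc ?srefM_K // pv_nasc // asc_pv_sref // aw.
rewrite scale0r addr0 {1}e -eapp_mul /Tbar mulrDl mulr_algl (T_sqr rel hi) addrAC -scalerDl.
by rewrite addrA subrK subrr scale0r add0r eappA.
Qed.

(** Peel off the last letter [i]. The unwanted terms would need [u], which ascends at [i], to equal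
    a permutation that descends there: [sref n i * w] if [w] ascends, [w] if it descends. *)
Lemma ev_Tw_Y u w : ev (eapp (Tw (Tbar eT) u) (Y w)) = (u == w)%:R * ev (Y 1%g).
Proof.
have br := Tbar_braided rel.
elim/perm_ind_pv: u w => [|u i hi au IH] w.
  rewrite Tw1 // eapp1; have [<-|nw] := eqVneq 1%g w; first by rewrite mul1r.
  by rewrite mul0r; apply/eqP; case: rep => _ [_ [_ [h _]]];
    rewrite -[_ == 0]negbK h eq_sym (negbTE nw).
rewrite Tw_right // eapp_mul Tbar_Y // eappDr !eappZr (evD sch_ev_lin).
rewrite !(evZ sch_ev_lin) !IH !mulrA -mulrDl; congr (_ * _).
have -> : (sref n i * u == w)%g = (u == sref n i * w)%g.
  by rewrite -[u in RHS](srefM_K i) (inj_eq (mulgI _)).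
case: ifP => aw.
  rewrite mul0r addr0; case: eqP => [eu|_]; last by rewrite mulr0.
  by move: au; rewrite eu asc_pv_sref // aw.
have [eu|_] := eqVneq u w; first by move: au; rewrite eu aw.
by rewrite mulr0 addr0 mul1r.
Qed.

(** Up to the factor [ev (Y 1%g)], the functionals given by [Tbar_w] followed by [ev] form the basis
    dual to the [Y w]. *)
Lemma sch_coef (v : V) : v = \sum_w (ev (eapp (Tw (Tbar eT) w) v) / ev (Y 1%g)) *: Y w.
Proof.
have [a {1 2}->] := sch_decomp v; apply: eq_bigr => w _; congr (_ *: _).
rewrite eapp_sumr (ev_sum sch_ev_lin) (bigD1 w) //= big1 => [|u nu].
  by rewrite eappZr (evZ sch_ev_lin) ev_Tw_Y eqxx mul1r addr0 mulfK // sch_ev1.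
by rewrite eappZr (evZ sch_ev_lin) ev_Tw_Y eq_sym (negbTE nu) mul0r mulr0.
Qed.

Lemma opeval_Ylam (k : nat) (f : {mpoly Ah[n]}) (l : part n k)
    (Q : 'S_n -> 'S_n -> {mpoly Ah[n]}) :
  (forall w, Tw (Tbar eT) w * heval eX f = \sum_u heval eX (Q w u) * Tw (Tbar eT) u) ->
  opeval phi X f (Ylam phi T Y0 l)
  = \sum_w mmap phi (fun i : 'I_n => t i) (coset_coef (Q w) l) *: Y w.
Proof.
move=> hQ; rewrite (opeval_eapp pV act) [LHS]sch_coef; apply: eq_bigr => w _.
congr (_ *: _); rewrite -eapp_mul hQ eapp_sum (ev_sum sch_ev_lin).
apply: (canLR (mulfK sch_ev1)).
rewrite /coset_coef raddf_sum /= mulr_suml.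
rewrite (eq_bigr (fun u => \sum_(v | young k v) mmap phi (fun i : 'I_n => t i) (Q w u)
   * (phi (pp ^+ plen v) * ((u == Defs.pcomp (wl l) v)%:R * ev (Y 1%g))))).
  rewrite exchange_big /=; apply: eq_bigr => v yv.
  rewrite (bigD1 (Defs.pcomp (wl l) v)) //= big1 => [|u /negbTE ->].
    by rewrite eqxx mul1r addr0 mmapZ mulrCA mulrA.
  by rewrite mul0r !mulr0.
move=> u _; rewrite eapp_mul (ev_heval pV act sch_ev_lin sch_ev_X).
rewrite /Ylam eapp_sumr (ev_sum sch_ev_lin) mulr_sumr; apply: eq_bigr => v yv.
by rewrite eappZr (evZ sch_ev_lin) ev_Tw_Y.
Qed.

End Schubert.

Theorem theorem4p5 (n k : nat) (f : {mpoly Ah[n]}) :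
  (k <= n)%N -> bisym k f ->
  (exists P : part n k -> part n k -> {mpoly Ah[n]}, expansion f P) /\
  (forall P : part n k -> part n k -> {mpoly Ah[n]}, expansion f P ->
    forall (F : fieldType) (phi : {rmorphism Ah -> F}) (t : nat -> F)
      (V : vectType F) (T X : nat -> V -> V) (Y0 : V) (ev : V -> F),
      schubert_rep n phi t T X Y0 ev ->
      forall l : part n k, is_part l ->
        opeval phi X f (Ylam phi T Y0 l)
        = \sum_(mu : part n k | is_part mu)
            mmap phi (fun i : 'I_n => t (val i)) (P l mu) *: Ylam phi T Y0 mu).
Proof.
move=> lekn fsym; split; first exact: expansion_ex.
move=> P expP F phi t V T X Y0 ev rep l pl.
have [Q hQ] := fin_all_exists (Tw_expand f).
have act : hecke_action n phi T X by case: rep.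
have rel := endalg_rel (sch_dim rep) act.
rewrite (opeval_Ylam l (fun w => hQ w _ _ _ rel)) (sum_young lekn).
apply: eq_bigr => mu pmu; rewrite /Ylam scaler_sumr; apply: eq_bigr => v yv.
(* The factor [p^l(v)] produced here is exactly the weight of [Y_(w_mu v)] in [Y_mu]. *)
by rewrite (expansion_coef lekn fsym hQ expP pl pmu yv) mmapZ scalerA mulrC.
Qed.
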